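(* Let $T$ be a closed densely defined linear operator in $\mathfrak H$. Then the following assertions (including the primed variants) are all equivalent: (i) $T$ is $\mathcal W$-similar to a nonnegative selfadjoint operator $S$, and $\rho(T)\ne\emptyset$; (ii) $XT=T^*X$ for some $X\in GL^+(\mathfrak H)$, and $\sigma(T)\subseteq[0,\infty)$; (iii) $T=X_1B_1$ with $X_1\in GL^+(\mathfrak H)$ and $B_1=B_1^*\ge0$; (iii$'$) $T^*=X_2B_2$ with $X_2\in GL^+(\mathfrak H)$ and $B_2=B_2^*\ge0$; (iv) $T=BX$ with $B=B^*\ge0$ and $X\in GL^+(\mathfrak H)$; (iv$'$) $T^*=B'Y$ with $B'=(B')^*\ge0$ and $Y\in GL^+(\mathfrak H)$; (v) there exists $W\in GL^+(\mathfrak H)$ such that $TW=(TW)^*\ge0$; (v$'$) there exists $Z\in GL^+(\mathfrak H)$ such that $ZT=(ZT)^*\ge0$; (vi) $T$ is a scalar operator and $\sigma(T)\subseteq[0,\infty)$. If one of the conditions (i), (ii), (iii), (iii$'$), (iv), (iv$'$), (v), (v$'$), (vi) holds, then $\overline{\mathrm{ran}}\,T\,\dot{+}\,\ker T=\mathfrak H$ (direct sum).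
   Context: $\mathfrak H$ is a complex Hilbert space; $B(\mathfrak H)$ denotes the bounded everywhere defined operators. $GL(\mathfrak H)$ is the set of bounded everywhere defined operators with bounded everywhere defined inverse, and $GL^+(\mathfrak H)$ is the set of nonnegative selfadjoint elements of $GL(\mathfrak H)$. Other selfadjoint operators may be unbounded; products have their natural domains. $T$ is $\mathcal W$-similar to $S$ if there is $G\in GL(\mathfrak H)$ with $GT\subseteq SG$; $T$ is similar to $S$ if there is $G\in GL(\mathfrak H)$ with $TG=GS$; $T$ is scalar if it is similar to a normal operator (possibly unbounded). $\rho(T)$ is the set of $\mu\in\mathbb C$ with $(T-\mu I)^{-1}\in B(\mathfrak H)$, and $\sigma(T)=\mathbb C\setminus\rho(T)$. *)

(* Defs.v *)
From HB Require Import structures.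
From mathcomp Require Import all_boot all_order all_algebra.
From mathcomp Require Import complex.
From mathcomp Require Import all_classical all_reals all_analysis.

Set Implicit Arguments.
Unset Strict Implicit.
Unset Printing Implicit Defensive.

Import Order.TTheory GRing.Theory Num.Theory.
Import numFieldNormedType.Exports.

Local Open Scope classical_set_scope.
Local Open Scope ring_scope.
Local Open Scope complex_scope.

(* Complex Hilbert spaces. The form is linear in its first argument and
   conjugate-linear in the second. *)
HB.mixin Record isHilbert (R : realType) H of CompleteNormedModule R[i] H := {
  hdot : {dot H for Num.conj};
  hdot_norm : forall x : H, hdot x x = `|x| ^+ 2 }.

#[short(type="hilbertType")]
HB.structure Definition Hilbert (R : realType) :=
  { H of CompleteNormedModule R[i] H & isHilbert R H }.

Notation "''[' x , y ]" := (hdot x y)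
  (at level 0, format "''[' x ,  y ]") : ring_scope.

Declare Scope operator_scope.
Delimit Scope operator_scope with oper.

(* A possibly unbounded operator is represented by its graph, so Leibniz
   equality of operators includes equality of domains and `<=` is extension. *)
Section Operators.
Variables (R : realType) (H : hilbertType R).
Implicit Types (S T : set (H * H)) (x y : H).

Definition dom T : set H := [set x | exists y, T (x, y)].
Definition ran T : set H := [set y | exists x, T (x, y)].
Definition ker T : set H := [set x | T (x, 0)].

Definition linear_operator T :=
  [/\ T (0, 0),
      (forall (a : R[i]) p q, T p -> T q -> T (a *: p + q)) &
      (forall x y y', T (x, y) -> T (x, y') -> y = y')].

(* In the library notation [T \; S], [S] is applied first, so this is the
   product T S on its natural domain { x in dom S | S x in dom T }. *)
Definition opmul T S : set (H * H) := (T \; S)%relation.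

(* The inverse relation; it is an operator exactly when T is injective. *)
Definition opinv T : set (H * H) := (T^-1)%relation.

Definition opshift T (mu : R[i]) : set (H * H) :=
  [set p | T (p.1, p.2 + mu *: p.1)].

(* As a relation it is defined for every T; it is single-valued exactly when
   dom T is dense. *)
Definition adjoint T : set (H * H) :=
  [set p | forall x y, T (x, y) -> '[y, p.1] = '[x, p.2]].

(* B(H) *)
Definition bounded_op T :=
  [/\ linear_operator T, dom T = setT &
      exists M : R, forall x y, T (x, y) -> `|y| <= M%:C * `|x|].

(* GL(H) *)
Definition invertible_op T := bounded_op T /\ bounded_op (opinv T).

Definition closed_densely_defined T :=
  [/\ linear_operator T, closed T & dense (dom T)].

Definition selfadjoint T :=
  [/\ linear_operator T, dense (dom T) & T = adjoint T].

(* In R[i], [0 <= z] means that z is real and nonnegative. *)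
Definition nonnegative_op T := forall x y, T (x, y) -> 0 <= '[y, x].

Definition nonneg_selfadjoint T := selfadjoint T /\ nonnegative_op T.

(* GL^+(H) *)
Definition pos_invertible_op T := invertible_op T /\ nonneg_selfadjoint T.

Definition normal T :=
  closed_densely_defined T /\ opmul (adjoint T) T = opmul T (adjoint T).

Definition W_similar T S :=
  exists G, invertible_op G /\ opmul G T `<=` opmul S G.

Definition similar T S :=
  exists G, invertible_op G /\ opmul T G = opmul G S.

Definition scalar_op T := exists N, normal N /\ similar T N.

Definition resolvent_set T : set R[i] :=
  [set mu | bounded_op (opinv (opshift T mu))].

Definition spectrum T : set R[i] := ~` resolvent_set T.

Definition direct_sum_decomposition (A B : set H) :=
  A `&` B = [set 0] /\ forall h, exists a b, [/\ A a, B b & h = a + b].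

End Operators.

Notation "T *o S" := (opmul T S) (at level 40, left associativity) : operator_scope.

(* Main.v *)
Require Import Defs.
From HB Require Import structures.
From mathcomp Require Import all_boot all_order all_algebra.
From mathcomp Require Import complex ring lra.
From mathcomp Require Import all_classical all_reals all_analysis.

Set Implicit Arguments.
Unset Strict Implicit.
Unset Printing Implicit Defensive.

Import Order.TTheory GRing.Theory Num.Theory.
Import numFieldNormedType.Exports.

Local Open Scope classical_set_scope.
Local Open Scope ring_scope.
Local Open Scope complex_scope.
Local Open Scope operator_scope.

(** All nine conditions say that [T = F^-1 S F] with [F] boundedly invertible and
    [S] nonnegative selfadjoint ([similar_to_nonneg] below), and the proof goes
    through this form.

    If [T = F^-1 S F], then [X = F^* F] and [Y = X^-1] are in GL^+, and
    [X T = F^* S F] and [T Y = F^-1 S (F^-1)^*] are congruent to [S], hence again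
    nonnegative selfadjoint; this gives (ii), (iii), (iv), (v), (v')
    ([similar_factorizations]). The adjoint [T^* = F^* S (F^-1)^*] has the same
    form, which gives (iii') and (iv'); [T^** = T] brings these back to [T].
    Conditions (i) and (vi) hold with [S] itself, because the spectrum of [S] lies
    in the half-line. The direct sum is the image by [F^-1] of the orthogonal sum
    of the closed range and the kernel of [S].

    Conversely, the square root [r] of a factor [X] in GL^+ is the similarity:
    [X B = r (r B r) r^-1] and [B X = r^-1 (r B r) r]. The square root is obtained
    as [1 - Y], where [Y] is the fixed point of a contraction ([square_root]).
    From (ii), [r T r^-1] is selfadjoint with spectrum in the half-line, and from
    (vi), [T] is similar to a normal operator with such a spectrum, so both follow
    from: a normal operator with spectrum in [[0, +oo[] is nonnegative selfadjoint
    ([normal_nonneg_spectrum]). From (i), [T] is contained in [F^-1 S F]; for [mu]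
    in the resolvent set of [T], the operator [T - mu] is onto, and [S - mu] is
    injective because its range is everything, so the inclusion is an equality.

    The theorem on normal operators is proved without a spectral measure. Normality
    gives [dom N = dom N^*] because [dom (N^* N)] is a core, so the bounded operator
    [A = (N + 1)^-1] commutes with its adjoint, and its spectrum is in [[0, 1]].
    The real part of the numerical range of a bounded normal operator [P + i Q]
    does not exceed that of its spectrum ([numerical_range_le]): the top [s] of the
    numerical range of [P] is an approximate eigenvalue of [P], and by
    commutation its approximate eigenvectors can be chosen to be approximate
    eigenvectors of [Q] as well ([approx_top]). Applied to [A], [- A], [i A] and
    [- i A], this shows that [A] is selfadjoint with [0 <= A <= 1], hence
    [N = A^-1 - 1] is selfadjoint and nonnegative. *)

(** * The real inner product underlying the hermitian form *)

Section RealInnerProduct.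
Variables (R : realType) (H : hilbertType R).
Implicit Types (x y z : H) (a : R) (c d : R[i]).

Definition rdot x y : R := complex.Re '[x, y].
Definition sqnorm x : R := rdot x x.

(** The notation [_^*] elaborates to convertible but syntactically different
    terms, which block rewriting; this constant gives conjugation a single form. *)
Definition cconj c : R[i] := c^*.

Lemma cconjK c : cconj (cconj c) = c.
Proof. exact: conjcK. Qed.

Lemma cconj0 : cconj 0 = 0.
Proof. exact: conjc0. Qed.

Lemma cconjD c d : cconj (c + d) = cconj c + cconj d.
Proof. exact: (rmorphD (@conjc R)). Qed.

Lemma hdotDl x y z : '[x + y, z] = '[x, z] + '[y, z].
Proof. exact: linearDl. Qed.

Lemma hdotZl c x y : '[c *: x, y] = c * '[x, y].
Proof. exact: linearZl_LR. Qed.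

Lemma hdotDr x y z : '[z, x + y] = '[z, x] + '[z, y].
Proof. exact: linearDr. Qed.

Lemma hdotZr c x y : '[x, c *: y] = cconj c * '[x, y].
Proof. exact: linearZr. Qed.

Lemma hdot0l x : '[0, x] = 0.
Proof. by rewrite -(scale0r x) hdotZl mul0r. Qed.

Lemma hdot0r x : '[x, 0] = 0.
Proof.
by rewrite -(scale0r x) hdotZr cconj0 mul0r.
Qed.

Lemma hdotC x y : '[y, x] = cconj '[x, y].
Proof.
have := @hermitian_subproof _ _ _ _ (@hdot R H) y x.
by rewrite expr0 mul1r => ->.
Qed.

Lemma hdotNl x y : '[- x, y] = - '[x, y].
Proof. by rewrite -scaleN1r hdotZl mulN1r. Qed.

Lemma hdotNr x y : '[x, - y] = - '[x, y].
Proof. exact: linearNr. Qed.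

Lemma rdotC x y : rdot x y = rdot y x.
Proof. by rewrite /rdot (hdotC x y); case: ('[x, y]). Qed.

Lemma rdotDl x y z : rdot (x + y) z = rdot x z + rdot y z.
Proof. by rewrite /rdot hdotDl raddfD. Qed.

Lemma rdotDr x y z : rdot z (x + y) = rdot z x + rdot z y.
Proof. by rewrite !(rdotC z) rdotDl. Qed.

Lemma rdotZl a x y : rdot (a%:C *: x) y = a * rdot x y.
Proof.
rewrite /rdot hdotZl; case: ('[x, y]) => u v /=.
by rewrite mul0r subr0.
Qed.

Lemma rdotZr a x y : rdot x (a%:C *: y) = a * rdot x y.
Proof. by rewrite !(rdotC x) rdotZl. Qed.

Lemma rdotNl x y : rdot (- x) y = - rdot x y.
Proof. by rewrite /rdot -scaleN1r hdotZl mulN1r raddfN. Qed.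

Lemma rdotNr x y : rdot x (- y) = - rdot x y.
Proof. by rewrite !(rdotC x) rdotNl. Qed.

Lemma rdotBl x y z : rdot (x - y) z = rdot x z - rdot y z.
Proof. by rewrite rdotDl rdotNl. Qed.

Lemma rdotBr x y z : rdot z (x - y) = rdot z x - rdot z y.
Proof. by rewrite rdotDr rdotNr. Qed.

Lemma rdot0l x : rdot 0 x = 0.
Proof. by rewrite -(scale0r x) rdotZl mul0r. Qed.

Lemma rdot0r x : rdot x 0 = 0.
Proof. by rewrite rdotC rdot0l. Qed.

Definition rdotE := (rdotDl, rdotDr, rdotBl, rdotBr, rdotNl, rdotNr,
  rdotZl, rdotZr, rdot0l, rdot0r).

(** Multiplication by the imaginary unit turns imaginary parts of the hermitian
    form into real ones, so a complex identity is a pair of real ones. *)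
Lemma hdotE x y : '[x, y] = rdot x y +i* rdot x ('i *: y).
Proof.
rewrite /rdot hdotZr; case: ('[x, y]) => u v /=.
by congr (_ +i* _); ring.
Qed.

Lemma rdotii x y : rdot ('i *: x) ('i *: y) = rdot x y.
Proof.
rewrite /rdot hdotZl hdotZr; case: ('[x, y]) => u v /=.
by ring.
Qed.

Lemma rdotiC x y : rdot ('i *: x) y = - rdot x ('i *: y).
Proof.
rewrite -[y in LHS]opprK -[y in LHS]scale1r -scaleNr -sqr_i expr2 -scalerA.
by rewrite rdotNr rdotii.
Qed.

Lemma sqnormi x : sqnorm ('i *: x) = sqnorm x.
Proof. exact: rdotii. Qed.

Lemma hdotxx x : '[x, x] = (sqnorm x)%:C.
Proof.
rewrite hdotE /sqnorm; congr (_ +i* _).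
have := rdotiC x x; rewrite rdotC; lra.
Qed.

Lemma hdot_eq x y z w :
  rdot x y = rdot z w -> rdot x ('i *: y) = rdot z ('i *: w) ->
  '[x, y] = '[z, w].
Proof. by rewrite !hdotE => -> ->. Qed.

Lemma sqnorm_ge0 x : 0 <= sqnorm x.
Proof. by rewrite -ler0c -hdotxx hdot_norm exprn_ge0. Qed.

Lemma norm_sqnorm x : `|x| = (Num.sqrt (sqnorm x))%:C.
Proof.
have h : `|x| ^+ 2 = (Num.sqrt (sqnorm x))%:C ^+ 2.
  by rewrite -hdot_norm hdotxx -rmorphXn /= sqr_sqrtr ?sqnorm_ge0.
by apply/eqP; rewrite -(@eqrXn2 _ 2) ?h // ler0c sqrtr_ge0.
Qed.

Lemma sqnorm_eq0 x : (sqnorm x == 0) = (x == 0).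
Proof.
apply/eqP/eqP => [h|->]; last by rewrite /sqnorm rdot0l.
by apply/eqP; rewrite -normr_eq0 norm_sqnorm h sqrtr0.
Qed.

Lemma sqnorm0 : sqnorm 0 = 0.
Proof. by rewrite /sqnorm rdot0l. Qed.

Lemma sqnorm_gt0 x : (0 < sqnorm x) = (x != 0).
Proof. by rewrite lt0r sqnorm_eq0 sqnorm_ge0 andbT. Qed.

Lemma sqnormN x : sqnorm (- x) = sqnorm x.
Proof. by rewrite /sqnorm rdotNl rdotNr opprK. Qed.

Lemma sqnormB x y : sqnorm (x - y) = sqnorm (y - x).
Proof. by rewrite -sqnormN opprB. Qed.

Lemma sqnormZ a x : sqnorm (a%:C *: x) = a ^+ 2 * sqnorm x.
Proof. by rewrite /sqnorm rdotZl rdotZr mulrA expr2. Qed.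

(** Evaluate the polynomial at its minimum [- b / c]. All Cauchy-Schwarz
    inequalities below come from this form. *)
Lemma quadratic_discr (a b c : R) : 0 <= c ->
  (forall t, 0 <= a + 2 * t * b + t ^+ 2 * c) -> b ^+ 2 <= a * c.
Proof.
rewrite le0r => /predU1P[->|c0] h.
  have [->|b0] := eqVneq b 0; first by rewrite mulr0 expr0n.
  (* a nonconstant affine function of t takes the value -1 *)
  exfalso; have := h (- (a + 1) / (2 * b)).
  have -> : a + 2 * (- (a + 1) / (2 * b)) * b = -1 by field.
  by rewrite mulr0 addr0 oppr_ge0 ler10.
have := h (- b / c).
rewrite -(@ler_pM2r _ c) // mul0r.
suff -> : (a + 2 * (- b / c) * b + (- b / c) ^+ 2 * c) * c = a * c - b ^+ 2.
  by rewrite subr_ge0.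
by field; rewrite gt_eqF.
Qed.

Lemma rdot_CS x y : rdot x y ^+ 2 <= sqnorm x * sqnorm y.
Proof.
apply: quadratic_discr => [|t]; first exact: sqnorm_ge0.
have := sqnorm_ge0 (x + t%:C *: y).
rewrite /sqnorm !rdotE (rdotC y x); lra.
Qed.

Lemma sqnormD_le x y : sqnorm (x + y) <= 2 * sqnorm x + 2 * sqnorm y.
Proof.
have := sqnorm_ge0 (x - y); rewrite /sqnorm !rdotE (rdotC y x); lra.
Qed.

Lemma sqnorm_dist_le x y z :
  sqnorm (x - z) <= 2 * sqnorm (x - y) + 2 * sqnorm (y - z).
Proof. by rewrite -(subrKA y x) sqnormD_le. Qed.

End RealInnerProduct.

(** * Topology in terms of the squared norm *)

Section SqnormTopology.
Variables (R : realType) (H : hilbertType R).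
Implicit Types (x y : H) (A : set H) (T : set (H * H)).

Lemma norm_lt_sqnorm x (e : R) : 0 < e ->
  (`|x| < e%:C) = (sqnorm x < e ^+ 2).
Proof.
move=> e0; rewrite norm_sqnorm ltcR.
by rewrite -{1}(gtr0_norm e0) -sqrtr_sqr ltr_sqrt ?exprn_gt0.
Qed.

Lemma ltc0P (e : R[i]) : 0 < e -> exists2 d : R, 0 < d & e = d%:C.
Proof.
case: e => a b; rewrite ltcE /= => /andP[/eqP -> a0].
by exists a.
Qed.

Lemma nbhs_sqnorm x A :
  nbhs x A <-> exists2 e : R, 0 < e & forall y, sqnorm (x - y) < e -> A y.
Proof.
split => [/nbhs_ballP[e /= /ltc0P[d d0 ->] h]|[e e0 h]].
  exists (d ^+ 2); first by rewrite exprn_gt0.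
  by move=> y hy; apply: h; rewrite -ball_normE /= norm_lt_sqnorm.
apply/nbhs_ballP; exists (Num.sqrt e)%:C; first by rewrite /= ltcR sqrtr_gt0.
move=> y; rewrite -ball_normE /= norm_lt_sqnorm ?sqrtr_gt0 //.
by rewrite sqr_sqrtr ?ltW // => /h.
Qed.

Lemma closure_sqnorm A x :
  closure A x <-> forall e : R, 0 < e -> exists2 y, A y & sqnorm (x - y) < e.
Proof.
split => [h e e0|h B /nbhs_sqnorm[e e0 hB]].
  have [|y [Ay hy]] := h [set y | sqnorm (x - y) < e].
    by apply/nbhs_sqnorm; exists e.
  by exists y.
by have [y Ay /hB By] := h _ e0; exists y.
Qed.

Lemma dense_sqnorm A :
  dense A <-> forall x (e : R), 0 < e -> exists2 y, A y & sqnorm (x - y) < e.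
Proof.
split => [h x e e0|h B [x Bx] oB].
  have [|y [By Ay]] := h [set y | sqnorm (x - y) < e]^° _ (open_interior _).
    by exists x; apply/nbhs_sqnorm; exists e.
  by exists y => //; apply: interior_subset By.
have /nbhs_sqnorm[e e0 hB] : nbhs x B by apply: open_nbhs_nbhs.
by have [y Ay /hB By] := h x e e0; exists y.
Qed.

Lemma closed_sqnorm T : closed T ->
  forall p, (forall e : R, 0 < e -> exists q, [/\ T q,
     sqnorm (p.1 - q.1) < e & sqnorm (p.2 - q.2) < e]) -> T p.
Proof.
move=> cT [x y] h; apply: cT => B [[B1 B2]] /=.
move=> [/nbhs_sqnorm[e1 e10 h1] /nbhs_sqnorm[e2 e20 h2]] sB.
have [|[u v] [Tq /= hu hv]] := h (Num.min e1 e2); first by rewrite lt_min e10.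
exists (u, v); split => //; apply: sB; split => /=.
  by apply: h1; apply: lt_le_trans hu _; rewrite ge_min lexx.
by apply: h2; apply: lt_le_trans hv _; rewrite ge_min lexx orbT.
Qed.

Lemma sqnorm_closed T :
  (forall p, (forall e : R, 0 < e -> exists q, [/\ T q,
     sqnorm (p.1 - q.1) < e & sqnorm (p.2 - q.2) < e]) -> T p) -> closed T.
Proof.
move=> h [x y] cl; apply: h => e e0 /=.
have [|[u v] [Tq /= [hu hv]]] :=
    cl ([set u | sqnorm (x - u) < e] `*` [set v | sqnorm (y - v) < e]).
  by exists ([set u | sqnorm (x - u) < e], [set v | sqnorm (y - v) < e]) => //=;
    split; apply/nbhs_sqnorm; exists e.
by exists (u, v).
Qed.

Lemma sqnorm_complete (u : nat -> H) :
  (forall e : R, 0 < e ->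
     exists N, forall n m, (N <= n)%N -> (N <= m)%N -> sqnorm (u n - u m) < e) ->
  exists l, forall e : R, 0 < e ->
     exists N, forall n, (N <= n)%N -> sqnorm (u n - l) < e.
Proof.
move=> h.
have /cauchy_cvg cu : cauchy (u @ \oo).
  apply: cauchy_exP => e /ltc0P[d d0 ->].
  have [N hN] := h (d ^+ 2) (exprn_gt0 _ d0).
  exists (u N); exists N => // n /= Nn.
  by rewrite -ball_normE /= norm_lt_sqnorm // hN.
exists (lim (u @ \oo)) => e e0.
have /cu [N _ hN] : nbhs (lim (u @ \oo)) [set y | sqnorm (lim (u @ \oo) - y) < e].
  by apply/nbhs_sqnorm; exists e.
by exists N => n /hN /=; rewrite sqnormB.
Qed.

End SqnormTopology.

(** * Orthogonal projection *)

Section Projection.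
Variables (R : realType) (H : hilbertType R).
Implicit Types (x y : H) (G : set (H * H)).

Definition subspace G :=
  G (0, 0) /\ forall (c : R[i]) p q, G p -> G q -> G (c *: p + q).

Lemma subspaceZ G (c : R[i]) p : subspace G -> G p -> G (c *: p).
Proof. by case=> G0 GP Gp; rewrite -[_ *: _]addr0; apply: GP. Qed.

Lemma subspaceD G p q : subspace G -> G p -> G q -> G (p + q).
Proof. by case=> G0 GP Gp Gq; rewrite -[p]scale1r; apply: GP. Qed.

Lemma subspaceB G p q : subspace G -> G p -> G q -> G (p - q).
Proof.
move=> sG Gp Gq; apply: subspaceD => //.
by rewrite -scaleN1r; apply: subspaceZ.
Qed.

(** The usual way in which equalities between limits are proved below. *)
Lemma small_eq0 (a b : R) : (forall e : R, 0 < e -> a <= e * b) -> 0 <= a -> a = 0.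
Proof.
move=> h a0; apply/eqP; rewrite eq_le a0 andbT.
apply/ler_addgt0Pr => e e0; rewrite add0r.
have b1 : 0 < `|b| + 1 by rewrite ltr_wpDl.
apply: le_trans (h (e / (`|b| + 1)) _) _; first by rewrite divr_gt0.
rewrite -mulrA ler_piMr ?(ltW e0) // ler_pdivrMl // mulr1.
by rewrite (le_trans (ler_norm b)) // lerDl.
Qed.

Lemma natSinv_small (e : R) : 0 < e ->
  exists N, forall n, (N <= n)%N -> n.+1%:R^-1 < e.
Proof.
move=> e0; have [N _ hN] := near_infty_natSinv_lt (PosNum e0).
by exists N => n /hN.
Qed.

(** The projection theorem in the Hilbert sum H + H. It is stated with pairs, as
    the norm of the product space H * H is the maximum of the norms of the
    components, and for a subspace that need not be closed, so that it applies to
    graphs as well as to subspaces of H. A minimizing sequence is Cauchy by the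
    parallelogram law; orthogonality of the limit is the limit of the almost
    orthogonality of the members of the sequence. *)
Lemma projection_pair_closure G : subspace G -> forall h k, exists x y,
  (forall e : R, 0 < e ->
     exists q, [/\ G q, sqnorm (x - q.1) < e & sqnorm (y - q.2) < e]) /\
  forall u v, G (u, v) -> '[h - x, u] + '[k - y, v] = 0.
Proof.
move=> sG h k; have [G0 GP] := sG.
pose D (p : H * H) := sqnorm (h - p.1) + sqnorm (k - p.2).
pose E := [set D p | p in G].
have D0 p : 0 <= D p by rewrite addr_ge0 ?sqnorm_ge0.
have hE : has_inf E.
  split; first by exists (D (0, 0)), (0, 0).
  by exists 0 => _ [p _ <-].
pose d := inf E.
have dD p : G p -> d <= D p.
  by move=> Gp; apply: ge_inf; [exact: hE.2 | exists p].
have /choice[w hw] : forall n : nat, exists p, G p /\ D p < d + n.+1%:R^-1.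
  move=> n; have [|_ [p Gp <-] Dp] := @inf_adherent _ E n.+1%:R^-1 _ hE.
    by rewrite invr_gt0.
  by exists p.
(* parallelogram law, with the midpoint in G *)
have par n m : sqnorm ((w n).1 - (w m).1) + sqnorm ((w n).2 - (w m).2) <=
    2 * n.+1%:R^-1 + 2 * m.+1%:R^-1.
  have [Gn Dn] := hw n; have [Gm Dm] := hw m.
  have Gnm : G ((2^-1)%:C *: w n + (2^-1)%:C *: w m).
    by apply: subspaceD => //; apply: subspaceZ.
  have := dD _ Gnm; move: Dn Dm.
  move: (n.+1%:R^-1) (m.+1%:R^-1) => en em.
  rewrite /D /=; case: (w n) (w m) => [a b] [a' b'] /=.
  rewrite /sqnorm !rdotE (rdotC a' a) (rdotC b' b) (rdotC a h) (rdotC a' h).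
  rewrite (rdotC b k) (rdotC b' k); lra.
have small (e : R) : 0 < e -> exists N, forall n m, (N <= n)%N -> (N <= m)%N ->
    sqnorm ((w n).1 - (w m).1) + sqnorm ((w n).2 - (w m).2) < e.
  move=> e0; have [|N hN] := @natSinv_small (e / 4); first by rewrite divr_gt0.
  exists N => n m /hN hn /hN hm; apply: le_lt_trans (par n m) _.
  move: hn hm; move: (n.+1%:R^-1) (m.+1%:R^-1) => en em; lra.
have [x hx] : exists l, forall e : R, 0 < e ->
     exists N, forall n, (N <= n)%N -> sqnorm ((w n).1 - l) < e.
  apply: (@sqnorm_complete _ _ (fun n => (w n).1)) => e /small[N hN].
  exists N => n m Nn Nm; apply: le_lt_trans (hN n m Nn Nm).
  by rewrite lerDl sqnorm_ge0.
have [y hy] : exists l, forall e : R, 0 < e ->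
     exists N, forall n, (N <= n)%N -> sqnorm ((w n).2 - l) < e.
  apply: (@sqnorm_complete _ _ (fun n => (w n).2)) => e /small[N hN].
  exists N => n m Nn Nm; apply: le_lt_trans (hN n m Nn Nm).
  by rewrite lerDr sqnorm_ge0.
exists x, y; split=> [e e0|].
  have [N1 h1] := hx e e0; have [N2 h2] := hy e e0.
  exists (w (maxn N1 N2)); split; first exact: (hw _).1.
    by rewrite sqnormB h1 // leq_maxl.
  by rewrite sqnormB h2 // leq_maxr.
have ortho u v : G (u, v) -> rdot (h - x) u + rdot (k - y) v = 0.
  move=> Guv; set b := (X in X = 0).
  pose W := sqnorm u + sqnorm v.
  suff : b ^+ 2 = 0 by move/eqP; rewrite sqrf_eq0 => /eqP.
  apply: (@small_eq0 _ (10 * W)); last exact: sqr_ge0.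
  move=> e e0; have [N1 h1] := hx e e0; have [N2 h2] := hy e e0.
  have [N3 h3] := natSinv_small e0.
  pose n := maxn N1 (maxn N2 N3).
  have {}h1 : sqnorm ((w n).1 - x) < e by rewrite h1 // leq_maxl.
  have {}h2 : sqnorm ((w n).2 - y) < e.
    by rewrite h2 // (leq_trans _ (leq_maxr _ _)) // leq_maxl.
  have {}h3 : n.+1%:R^-1 < e.
    by rewrite h3 // (leq_trans _ (leq_maxr _ _)) // leq_maxr.
  pose bn := rdot (h - (w n).1) u + rdot (k - (w n).2) v.
  have [Gn Dn] := hw n.
  (* D along the line through w n in the direction (u, v) stays above its infimum *)
  have bnW : bn ^+ 2 <= n.+1%:R^-1 * W.
    rewrite -sqrrN; apply: quadratic_discr => [|t].
      by rewrite addr_ge0 ?sqnorm_ge0.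
    have := dD _ (subspaceD sG Gn (subspaceZ (t%:C) sG Guv)).
    rewrite /D in Dn *; move: Dn; move: (n.+1%:R^-1) => en /=.
    rewrite /bn /W !opprD !addrA; move: (h - (w n).1) (k - (w n).2) => h' k'.
    rewrite /sqnorm !rdotE (rdotC u h') (rdotC v k'); lra.
  have C1 := rdot_CS ((w n).1 - x) u; have C2 := rdot_CS ((w n).2 - y) v.
  have bE : b = bn + (rdot ((w n).1 - x) u + rdot ((w n).2 - y) v).
    rewrite /b /bn !rdotE; lra.
  have U0 := sqnorm_ge0 u; have V0 := sqnorm_ge0 v.
  rewrite bE /W in bnW *; clear bE; clearbody bn.
  move: C1 C2 h1 h2 h3; move: (rdot _ _) (rdot _ _) => r2 r1.
  move: (sqnorm (_ - x)) (sqnorm (_ - y)) (n.+1%:R^-1) bn bnW => s1 s2 en bn'.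
  move=> bnW C1 C2 h1 h2 h3.
  have c1 : r1 ^+ 2 <= e * sqnorm u.
    by apply: le_trans C1 _; rewrite ler_wpM2r // ltW.
  have c2 : r2 ^+ 2 <= e * sqnorm v.
    by apply: le_trans C2 _; rewrite ler_wpM2r // ltW.
  have c3 : bn' ^+ 2 <= e * (sqnorm u + sqnorm v).
    by apply: le_trans bnW _; rewrite ler_wpM2r ?addr_ge0 // ltW.
  have := sqr_ge0 (r1 - r2); have := sqr_ge0 (bn' - (r1 + r2)).
  have : 0 <= e * sqnorm u by rewrite mulr_ge0 // ltW.
  have : 0 <= e * sqnorm v by rewrite mulr_ge0 // ltW.
  move: (sqnorm u) (sqnorm v) c1 c2 c3 => su sv; lra.
move=> u v Guv; rewrite !hdotE.
have /= := ortho _ _ (subspaceZ 'i sG Guv); have := ortho _ _ Guv.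
move=> e1 e2; apply/eqP; rewrite eq_complex /=.
by apply/andP; split; apply/eqP.
Qed.

Lemma projection_pair G : subspace G -> closed G -> forall h k, exists x y,
  G (x, y) /\ forall u v, G (u, v) -> '[h - x, u] + '[k - y, v] = 0.
Proof.
move=> sG cG h k; have [x [y [Gxy o]]] := projection_pair_closure sG h k.
by exists x, y; split=> //; apply: (closed_sqnorm cG).
Qed.

Lemma projection_closure (A : set H) : A 0 ->
  (forall (c : R[i]) x y, A x -> A y -> A (c *: x + y)) ->
  forall h, exists2 x, closure A x & forall u, A u -> '[h - x, u] = 0.
Proof.
move=> A0 AP h; pose G : set (H * H) := [set p | A p.1 /\ p.2 = 0].
have sG : subspace G.
  split=> [|c [x y] [x' y'] [/= Ax y0] [/= Ax' y'0]] //; split=> /=; first exact: AP.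
  by rewrite y0 y'0 scaler0 addr0.
have [x [y [cl o]]] := projection_pair_closure sG h 0.
exists x => [|u Au].
  by apply/closure_sqnorm => e /cl[[a b] [[/= Aa _] ha _]]; exists a.
have := o u 0 (conj Au erefl).
by rewrite hdot0r addr0.
Qed.

End Projection.

(** * Bounded operators as functions, and their adjoints *)

Section BoundedLinear.
Variables (R : realType) (H : hilbertType R).
Implicit Types (x y : H) (f g : H -> H) (T : set (H * H)).

Definition bounded_linear f :=
  (forall (c : R[i]) x y, f (c *: x + y) = c *: f x + f y) /\
  exists2 M : R, 0 < M & forall x, sqnorm (f x) <= M * sqnorm x.

Definition graph_of f : set (H * H) := [set p | f p.1 = p.2].

Definition isomorphism f g :=
  [/\ bounded_linear f, bounded_linear g, cancel f g & cancel g f].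

Definition adjoint_fun f g := forall x y, '[f x, y] = '[x, g y].

Lemma blD f x y : bounded_linear f -> f (x + y) = f x + f y.
Proof. by case=> lf _; rewrite -[x in LHS]scale1r lf scale1r. Qed.

Lemma bl0 f : bounded_linear f -> f 0 = 0.
Proof.
move=> bf; apply: (addrI (f 0)).
by rewrite -(blD _ _ bf) !addr0.
Qed.

Lemma blZ f (c : R[i]) x : bounded_linear f -> f (c *: x) = c *: f x.
Proof. by move=> bf; rewrite -[_ *: x]addr0 bf.1 (bl0 bf) addr0. Qed.

Lemma blN f x : bounded_linear f -> f (- x) = - f x.
Proof. by move=> bf; rewrite -scaleN1r (blZ _ _ bf) scaleN1r. Qed.

Lemma blB f x y : bounded_linear f -> f (x - y) = f x - f y.
Proof. by move=> bf; rewrite (blD _ _ bf) (blN _ bf). Qed.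

Lemma bounded_linear_comp f g :
  bounded_linear f -> bounded_linear g -> bounded_linear (f \o g).
Proof.
move=> [lf [M M0 hM]] [lg [K K0 hK]]; split=> [c x y|]; first by rewrite /= lg lf.
exists (M * K); first exact: mulr_gt0.
move=> x /=; apply: le_trans (hM _) _.
by rewrite -mulrA ler_pM2l.
Qed.

Lemma bounded_linearD f g : bounded_linear f -> bounded_linear g ->
  bounded_linear (fun x => f x + g x).
Proof.
move=> [lf [M M0 hM]] [lg [K K0 hK]]; split=> [c x y|].
  by rewrite lg lf scalerDr addrACA.
exists (2 * M + 2 * K); first by rewrite addr_gt0 ?mulr_gt0.
move=> x /=; apply: le_trans (sqnormD_le _ _) _.
have := hM x; have := hK x; lra.
Qed.

Lemma sqnormZc (c : R[i]) x :
  sqnorm (c *: x) = (complex.Re c ^+ 2 + complex.Im c ^+ 2) * sqnorm x.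
Proof.
rewrite /sqnorm /rdot hdotZl hdotZr hdotxx.
by case: c => a b /=; ring.
Qed.

Lemma bounded_linearZ f (c : R[i]) : bounded_linear f ->
  bounded_linear (fun x => c *: f x).
Proof.
move=> [lf [M M0 hM]]; split=> [d x y|].
  by rewrite lf scalerDr !scalerA mulrC.
have N0 : 0 <= complex.Re c ^+ 2 + complex.Im c ^+ 2 by rewrite addr_ge0 ?sqr_ge0.
exists ((complex.Re c ^+ 2 + complex.Im c ^+ 2 + 1) * M).
  by rewrite mulr_gt0 // ltr_wpDl.
move=> x; rewrite sqnormZc -mulrA ler_pM ?sqnorm_ge0 //.
by rewrite lerDl.
Qed.

Lemma bounded_linear_id : bounded_linear id.
Proof. by split=> //; exists 1 => // x; rewrite mul1r. Qed.

(** Bounded operators are handled as functions; their graphs are used only to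
    connect with the statements on unbounded operators. *)
Lemma bounded_opP T : bounded_op T <->
  exists2 f, bounded_linear f & T = graph_of f.
Proof.
split=> [[[T0 TP Tf] dT [M hM]]|[f bf ->]].
  have /choice[f hf] : forall x, exists y, T (x, y).
    by move=> x; have : dom T x by rewrite dT.
  exists f.
    split=> [c x y|]; first by apply: Tf (hf _) _; exact: TP c _ _ (hf x) (hf y).
    exists (M ^+ 2 + 1); first by rewrite ltr_wpDl ?sqr_ge0.
    move=> x; have := hM _ _ (hf x); rewrite !norm_sqnorm -rmorphM lecR => h.
    have s0 := sqrtr_ge0 (sqnorm (f x)).
    have : Num.sqrt (sqnorm (f x)) ^+ 2 <= (M * Num.sqrt (sqnorm x)) ^+ 2.
      by rewrite ler_pXn2r // nnegrE // (le_trans s0).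
    rewrite exprMn !sqr_sqrtr ?sqnorm_ge0 // => {}h.
    by apply: le_trans h _; rewrite mulrDl mul1r lerDl sqnorm_ge0.
  apply/seteqP; split=> -[x y]; rewrite /graph_of /=; last by move=> <-.
  exact: Tf (hf x).
have [lf [M M0 hM]] := bf; split; last 2 first.
- by apply/seteqP; split=> // x _; exists (f x).
- exists (Num.sqrt M) => x y; rewrite /graph_of /= => <-; rewrite !norm_sqnorm -rmorphM lecR.
  by rewrite -sqrtrM ?ler_sqrt ?hM ?mulr_ge0 ?sqnorm_ge0 // ltW.
rewrite /graph_of; split=> [|c [x y] [x' y'] /= <- <-|x y y' /= <-] //=.
exact: bl0.
Qed.

Lemma invertible_opP T : invertible_op T <->
  exists f g, isomorphism f g /\ T = graph_of f.
Proof.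
split=> [[/bounded_opP[f bf Tf] /bounded_opP[g bg Tg]]|[f [g [[bf bg fK gK] ->]]]].
  exists f, g; split=> //; split=> // x.
    have : opinv T (f x, x) by rewrite /opinv /= Tf.
    by rewrite Tg.
  have : opinv T (x, g x) by rewrite Tg.
  by rewrite Tf.
split; first by apply/bounded_opP; exists f.
apply/bounded_opP; exists g => //; apply/seteqP; split=> -[x y]; rewrite /opinv /graph_of /=.
  by move=> <-; rewrite fK.
by move=> <-; rewrite gK.
Qed.

Lemma isomorphism_sym f g : isomorphism f g -> isomorphism g f.
Proof. by case. Qed.

Lemma isomorphism_comp f f' g g' : isomorphism f f' -> isomorphism g g' ->
  isomorphism (f \o g) (g' \o f').
Proof.
move=> [bf bf' fK f'K] [bg bg' gK g'K]; split.
- exact: bounded_linear_comp.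
- exact: bounded_linear_comp.
- by move=> x /=; rewrite fK gK.
- by move=> x /=; rewrite g'K f'K.
Qed.

Lemma hdot_extr x y : (forall z, '[z, x] = '[z, y]) -> x = y.
Proof.
move=> h; apply/eqP; rewrite -subr_eq0 -sqnorm_eq0.
by rewrite /sqnorm rdotBr /rdot h subrr.
Qed.

Lemma adjoint_fun_sym f g : adjoint_fun f g -> adjoint_fun g f.
Proof. by move=> h x y; rewrite hdotC -h -hdotC. Qed.

(** [|g x|^2 = <f (g x), x> <= |f (g x)| |x|] bounds [g] by the norm of [f]. *)
Lemma adjoint_fun_bounded f g :
  bounded_linear f -> adjoint_fun f g -> bounded_linear g.
Proof.
move=> [lf [M M0 hM]] h; split=> [c x y|].
  by apply: hdot_extr => z; rewrite -h !hdotDr !hdotZr -!h.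
exists M => // x; have [->|gx0] := eqVneq (g x) 0.
  by rewrite sqnorm0 mulr_ge0 ?sqnorm_ge0 // ltW.
rewrite -sqnorm_gt0 in gx0; rewrite -(ler_pM2r gx0).
have := rdot_CS (f (g x)) x.
rewrite {1}/rdot h hdotxx /= expr2 => /le_trans; apply.
have := ler_wpM2r (sqnorm_ge0 x) (hM (g x)).
by move/le_trans; apply; rewrite mulrAC.
Qed.

(** Riesz representation of the functional [phi] sending [u] to [<f u, v>]: if it
    does not vanish, it is represented by a multiple of the component [n],
    orthogonal to its kernel, of a vector outside the kernel. *)
Lemma adjoint_fun_exists f : bounded_linear f ->
  exists2 g, bounded_linear g & adjoint_fun f g.
Proof.
move=> bf; suff /choice[g hg] : forall v, exists w, forall u, '[f u, v] = '[u, w].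
  have ag : adjoint_fun f g by move=> x y; exact: hg.
  by exists g => //; exact: adjoint_fun_bounded ag.
move=> v; pose phi u := '[f u, v].
have phiP c x y : phi (c *: x + y) = c * phi x + phi y.
  by rewrite /phi bf.1 hdotDl hdotZl.
have [|/existsNP[h /eqP ph]] := pselect (forall u, phi u = 0).
  by move=> p0; exists 0 => u; rewrite hdot0r; exact: p0.
have phi0 : phi 0 = 0 by rewrite /phi (bl0 bf) hdot0l.
have [|m clm om] := @projection_closure _ _ [set u | phi u = 0] phi0 _ h.
  by move=> c x y /= px py; rewrite phiP px py mulr0 addr0.
(* the kernel of phi is closed *)
have phim : phi m = 0.
  have [M M0 hM] := bf.2; move/closure_sqnorm: clm => clm.
  have z w : (forall u, phi u = 0 -> rdot (f u) w = 0) -> rdot (f m) w = 0.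
    move=> hw; suff : rdot (f m) w ^+ 2 = 0 by move/eqP; rewrite sqrf_eq0 => /eqP.
    apply: (@small_eq0 _ _ (M * sqnorm w)); last exact: sqr_ge0.
    move=> e e0; have [u /hw pu hu] := clm e e0.
    rewrite -[rdot _ _]subr0 -pu -rdotBl -(blB _ _ bf).
    apply: le_trans (rdot_CS _ _) _; rewrite mulrA ler_wpM2r ?sqnorm_ge0 //.
    by apply: le_trans (hM _) _; rewrite mulrC ler_pM2r // ltW.
  by rewrite /phi hdotE !z // => u; rewrite /phi hdotE => -[].
set n := h - m in om.
have phn : phi n != 0 by rewrite /n -scaleN1r addrC phiP phim mulr0 add0r.
have n0 : '[n, n] != 0.
  rewrite hdotxx; apply: contra phn => /eqP[] /eqP.
  by rewrite sqnorm_eq0 => /eqP ->; rewrite phi0.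
exists (cconj (phi n / '[n, n]) *: n) => u.
have : phi (- (phi u / phi n) *: n + u) = 0.
  by rewrite phiP mulNr divfK // addNr.
move/om; rewrite hdotC hdotDl hdotZl => /(congr1 (@cconj R)).
rewrite cconjK cconj0 mulNr => /eqP; rewrite addrC subr_eq0 => /eqP h1.
rewrite hdotZr cconjK h1 -/(phi u).
by field; rewrite phn.
Qed.

End BoundedLinear.

(** * Adjoints and congruences of unbounded operators *)

Section Transport.
Variables (R : realType) (H : hilbertType R).
Implicit Types (x y : H) (f g : H -> H) (S T X : set (H * H)).

Lemma linear_operator_subspace T : linear_operator T -> subspace T.
Proof. by case. Qed.

Lemma subspace_adjoint T : subspace (adjoint T).
Proof.
split=> [x y _|c p q hp hq x y Txy] /=; first by rewrite !hdot0r.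
by rewrite !hdotDr !hdotZr (hp _ _ Txy) (hq _ _ Txy).
Qed.

Lemma rdot_limit x y w :
  (forall e : R, 0 < e -> exists2 z, sqnorm (x - z) < e & rdot z w = rdot z y) ->
  rdot x w = rdot x y.
Proof.
move=> h; apply/eqP; rewrite -subr_eq0 -rdotBr; apply/eqP.
suff : rdot x (w - y) ^+ 2 = 0 by move/eqP; rewrite sqrf_eq0 => /eqP.
apply: (@small_eq0 _ _ (sqnorm (w - y))); last exact: sqr_ge0.
move=> e e0; have [z hz ez] := h e e0.
rewrite -(subrK z x) rdotDl [rdot z _]rdotBr ez subrr addr0.
by apply: le_trans (rdot_CS _ _) _; rewrite ler_wpM2r ?sqnorm_ge0 // ltW.
Qed.

Lemma adjoint_closed T : closed (adjoint T).
Proof.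
apply: sqnorm_closed => -[a b] h x y Txy /=.
have key u v : (forall p, adjoint T p -> rdot p.1 u = rdot p.2 v) ->
    rdot a u = rdot b v.
  move=> huv; apply/eqP; rewrite -subr_eq0; apply/eqP.
  set d := _ - _; suff : d ^+ 2 = 0 by move/eqP; rewrite sqrf_eq0 => /eqP.
  apply: (@small_eq0 _ _ (2 * sqnorm u + 2 * sqnorm v)); last exact: sqr_ge0.
  move=> e e0; have [p [/huv ep h1 h2]] := h e e0.
  have -> : d = rdot (a - p.1) u - rdot (b - p.2) v.
    by rewrite !rdotBl ep /d; lra.
  have := rdot_CS (a - p.1) u; have := rdot_CS (b - p.2) v.
  have := ler_wpM2r (sqnorm_ge0 u) (ltW h1).
  have := ler_wpM2r (sqnorm_ge0 v) (ltW h2).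
  have := sqr_ge0 (rdot (a - p.1) u + rdot (b - p.2) v).
  lra.
rewrite (hdotC a) (hdotC b); congr cconj.
apply: hdot_eq; apply: key => -[p1 p2] /= /(_ x y Txy) E.
  by rewrite !(rdotC _ y) !(rdotC _ x) /rdot E.
rewrite !(rdotC _ ('i *: _)) /rdot !hdotZl; congr (complex.Re ('i * _)); exact: E.
Qed.

(** The component [(r, s)] orthogonal to [T] of a vector of [T^**] is again in
    [T^**], while [(s, - r)] is in [T^*]; pairing them gives [|r|^2 + |s|^2 = 0]. *)
Lemma adjoint_adjoint T : subspace T -> closed T -> adjoint (adjoint T) = T.
Proof.
move=> sT cT.
have sub p : T p -> adjoint (adjoint T) p.
  by case: p => x y Txy a b /(_ x y Txy) /= E; rewrite (hdotC x) (hdotC y) E.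
apply/seteqP; split=> -[h k] hk; last exact: sub.
have [x [y [Txy o]]] := projection_pair sT cT h k.
have : adjoint (adjoint T) (h - x, k - y).
  exact: (subspaceB (subspace_adjoint _) hk (sub _ Txy)).
have oT : adjoint T (k - y, - (h - x)).
  move=> u v /o /= /(congr1 (@cconj R)).
  rewrite cconj0 cconjD -!hdotC hdotNr => /eqP.
  by rewrite addrC addr_eq0 => /eqP.
move=> /(_ _ _ oT) /= /(congr1 (@complex.Re R)).
rewrite -/(rdot _ _) -/(rdot _ _) rdotNl -/(sqnorm _) -/(sqnorm _).
have := sqnorm_ge0 (h - x); have := sqnorm_ge0 (k - y) => n1 n2 E.
have /eqP : sqnorm (h - x) = 0 by lra.
have /eqP : sqnorm (k - y) = 0 by lra.
by rewrite !sqnorm_eq0 !subr_eq0 => /eqP -> /eqP ->.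
Qed.

Lemma hdot_dense (A : set H) x y :
  dense A -> (forall z, A z -> '[z, x] = '[z, y]) -> x = y.
Proof.
move=> /dense_sqnorm dA h; apply: hdot_extr => z.
by apply: hdot_eq; apply: rdot_limit => e e0;
  have [w Aw hw] := dA z e e0; exists w => //;
  have := h w Aw; rewrite !hdotE => -[].
Qed.

(** This is [g^-1 T f]. It covers the products of [T] by bounded operators on
    either side, similarity (for [g = f]) and congruence (for [g^-1 = f^*]). *)
Definition transport f g T : set (H * H) := [set p | T (f p.1, g p.2)].

Lemma opmul_graphl f g T : isomorphism f g ->
  opmul (graph_of f) T = transport id g T.
Proof.
move=> [_ _ fK gK]; apply/seteqP; split=> -[x z]; rewrite /opmul /graph_of /transport /=.
  by case=> y Ty <-; rewrite fK.
by move=> Tz; exists (g z).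
Qed.

Lemma opmul_graphr f T : opmul T (graph_of f) = transport f id T.
Proof.
apply/seteqP; split=> -[x z]; rewrite /opmul /graph_of /transport /=.
  by case=> y <-.
by move=> Tz; exists (f x).
Qed.

Lemma transport_comp f f' g g' T :
  transport f g (transport f' g' T) = transport (f' \o f) (g' \o g) T.
Proof. by []. Qed.

Lemma transport_eq f f' g g' T : f =1 f' -> g =1 g' ->
  transport f g T = transport f' g' T.
Proof. by move=> /funext -> /funext ->. Qed.

Lemma transportK f g f' g' T : cancel f f' -> cancel g g' ->
  transport f g (transport f' g' T) = T.
Proof.
by move=> fK gK; apply/seteqP; split=> -[x y]; rewrite /transport /= fK gK.
Qed.

(** This is [(g^-1 T f)^* = f^* T^* (g^-1)^*]; here [fs] and [gs] are the adjoints of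
    the inverses [f'] and [g']. *)
Lemma adjoint_transport f f' g g' fs gs T :
  isomorphism f f' -> isomorphism g g' ->
  adjoint_fun f' fs -> adjoint_fun g' gs ->
  adjoint (transport f g T) = transport gs fs (adjoint T).
Proof.
move=> [_ _ fK f'K] [_ _ gK g'K] af ag; apply/seteqP; split=> -[a b] h x y /= Txy.
  by rewrite -ag -af; apply: h; rewrite /transport /= f'K g'K.
by have := h _ _ Txy; rewrite /= -ag -af fK gK.
Qed.

Lemma isomorphism_adjoint f f' fs fs' : isomorphism f f' ->
  adjoint_fun f fs -> adjoint_fun f' fs' -> isomorphism fs fs'.
Proof.
move=> [bf bf' fK f'K] af af'; split.
- exact: adjoint_fun_bounded af.
- exact: adjoint_fun_bounded af'.
- by move=> x; apply: hdot_extr => z; rewrite -af' -af f'K.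
- by move=> x; apply: hdot_extr => z; rewrite -af -af' fK.
Qed.

Lemma linear_operator_transport f f' g g' T : isomorphism f f' -> isomorphism g g' ->
  linear_operator T -> linear_operator (transport f g T).
Proof.
move=> [bf _ _ _] [bg _ gK _] [T0 TP Tf]; split.
- by rewrite /transport /= (bl0 bf) (bl0 bg).
- move=> c [x y] [x' y']; rewrite /transport /= bf.1 bg.1; exact: TP.
- by move=> x y y'; rewrite /transport /= => h h'; apply: (can_inj gK); apply: Tf h h'.
Qed.

Lemma dense_dom_transport f f' g g' T : isomorphism f f' -> isomorphism g g' ->
  dense (dom T) -> dense (dom (transport f g T)).
Proof.
move=> [bf [lf' [M M0 hM]] fK f'K] [bg _ gK g'K] /dense_sqnorm dT.
apply/dense_sqnorm => x e e0.
have [|u [v Tuv] hu] := dT (f x) (e / M); first by rewrite divr_gt0.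
exists (f' u); first by exists (g' v); rewrite /transport /= f'K g'K.
rewrite -(fK x) -(blB _ _ (conj lf' (ex_intro2 _ _ M M0 hM))).
by apply: le_lt_trans (hM _) _; rewrite mulrC -ltr_pdivlMr.
Qed.

(** The congruence [f^* S f]. *)
Lemma selfadjoint_transport f f' fs fs' S : isomorphism f f' ->
  adjoint_fun f fs -> adjoint_fun f' fs' ->
  selfadjoint S -> selfadjoint (transport f fs' S).
Proof.
move=> iso af af' [lS dS aS]; have iso' := isomorphism_adjoint iso af af'.
split.
- exact: linear_operator_transport iso (isomorphism_sym iso') lS.
- exact: dense_dom_transport iso (isomorphism_sym iso') dS.
- rewrite (adjoint_transport _ iso (isomorphism_sym iso') af' (adjoint_fun_sym af)).
  by rewrite -aS.
Qed.

Lemma nonneg_selfadjoint_transport f f' fs fs' S : isomorphism f f' ->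
  adjoint_fun f fs -> adjoint_fun f' fs' ->
  nonneg_selfadjoint S -> nonneg_selfadjoint (transport f fs' S).
Proof.
move=> iso af af' [sS nS]; split; first exact: selfadjoint_transport af af' sS.
have [_ _ fsK fs'K] := isomorphism_adjoint iso af af'.
move=> x y; rewrite /transport /= => /nS; rewrite (adjoint_fun_sym af').
by have [_ _ fK _] := iso; rewrite fK.
Qed.

Lemma bounded_op_transport f f' g g' T : isomorphism f f' -> isomorphism g g' ->
  bounded_op T -> bounded_op (transport f g T).
Proof.
move=> [bf _ _ _] [_ bg' gK g'K] /bounded_opP[t bt ->]; apply/bounded_opP.
exists (g' \o t \o f).
  by do 2 apply: bounded_linear_comp => //.
apply/seteqP; split=> -[x y]; rewrite /transport /graph_of /=.
  by move=> ->; rewrite gK.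
by move=> <-; rewrite g'K.
Qed.

Lemma resolvent_set_transport f f' T : isomorphism f f' ->
  resolvent_set T `<=` resolvent_set (transport f f T).
Proof.
move=> iso mu h; have [bf _ _ _] := iso.
have := bounded_op_transport iso iso h; congr bounded_op.
apply/seteqP; split=> -[y x]; rewrite /transport /opinv /opshift /=;
  by rewrite (blD _ _ bf) (blZ _ _ bf).
Qed.

Definition symmetric_fun f := adjoint_fun f f.

Lemma symmetric_funP f : (forall x y, rdot (f x) y = rdot x (f y)) ->
  bounded_linear f -> symmetric_fun f.
Proof.
by move=> h bf x y; apply: hdot_eq; rewrite h // (blZ _ _ bf).
Qed.

Lemma pos_invertible_opP X : pos_invertible_op X <-> exists f g,
  [/\ isomorphism f g, symmetric_fun f, forall x, 0 <= rdot (f x) x &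
      X = graph_of f].
Proof.
split=> [[/invertible_opP[f [g [iso ->]]] [[_ _ aX] nX]]|[f [g [iso sf pf ->]]]].
  exists f, g; split=> //.
    move=> x y; have : graph_of f (y, f y) by [].
    by rewrite aX => /(_ x (f x) erefl).
  by move=> x; have := nX x (f x) erefl; rewrite lecE => /andP[].
split; first by apply/invertible_opP; exists f, g.
have [bf _ _ _] := iso.
have lf : linear_operator (graph_of f).
  have /bounded_opP[] // : exists2 f', bounded_linear f' & graph_of f = graph_of f'.
  by exists f.
split; last first.
  move=> x y; rewrite /graph_of /= => <-; rewrite hdotE lecE /= pf andbT.
  have := sf x ('i *: x) => /(congr1 (@complex.Re R)); rewrite -!/(rdot _ _).
  rewrite (blZ _ _ bf) -[X in _ = X]opprK -rdotiC (rdotC _ (f x)) => E.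
  by apply/eqP; lra.
split=> //.
  apply/dense_sqnorm => x e e0; exists x; first by exists (f x).
  by rewrite subrr sqnorm0.
apply/seteqP; split=> -[a b]; rewrite /graph_of /=.
  by move=> <- x y; rewrite /= => <-.
move=> h; apply: hdot_extr => z; rewrite -sf; exact: (h z (f z) erefl).
Qed.

End Transport.

(** * Spectrum, range and kernel of selfadjoint operators *)

Section SelfadjointSpectrum.
Variables (R : realType) (H : hilbertType R).
Implicit Types (x y : H) (S T : set (H * H)) (mu : R[i]).

Lemma scale_complexE (c : R[i]) x :
  c *: x = (complex.Re c)%:C *: x + (complex.Im c)%:C *: ('i *: x).
Proof.
rewrite scalerA -scalerDl; congr (_ *: _).
by case: c => a b; apply/eqP; rewrite eq_complex /=; apply/andP; split; apply/eqP; ring.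
Qed.

(** A lower bound on [|r|], the size of the inner product of two vectors of squared
    norms [n] and [s], turned into a lower bound on [n]. *)
Lemma CS_lower_bound (c r s n : R) :
  0 <= s -> 0 <= c -> c * s <= `|r| -> r ^+ 2 <= n * s -> 0 <= n ->
  c ^+ 2 * s <= n.
Proof.
rewrite le0r => /predU1P[-> _ _ _ n0|s0 c0 h1 h2 n0]; first by rewrite mulr0.
rewrite -(ler_pM2r s0); apply: le_trans h2.
rewrite -[r ^+ 2]real_normK ?num_real // -mulrA -expr2 -exprMn.
by rewrite ler_pXn2r // nnegrE // mulr_ge0 // ltW.
Qed.

(** As [<S x, x> >= 0], the number [<(S - mu) x, x>] has imaginary part
    [- Im mu |x|^2] and real part at least [- Re mu |x|^2]. *)
Lemma nonneg_lower_bound S mu : nonnegative_op S -> ~~ (0 <= mu) ->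
  exists2 d : R, 0 < d &
    forall x y, S (x, y) -> d * sqnorm x <= sqnorm (y - mu *: x).
Proof.
move=> nS; rewrite lecE negb_and /=.
have [b0|b0 _] := eqVneq (complex.Im mu) 0 => /= [a0|]; last first.
  exists (`|complex.Im mu| ^+ 2) => [|x y /nS]; first by rewrite exprn_gt0 ?normr_gt0.
  rewrite lecE hdotE /= => /andP[/eqP E _].
  apply: (@CS_lower_bound _ (rdot (y - mu *: x) ('i *: x))) => //; rewrite ?sqnorm_ge0 //.
    rewrite scale_complexE !rdotE E rdotii -/(sqnorm x).
    have := rdotiC x x; rewrite rdotC => E2.
    have E3 : rdot x ('i *: x) = 0 by lra.
    rewrite E3 (_ : 0 - _ = - (complex.Im mu * sqnorm x)); last by ring.
    by rewrite normrN normrM (ger0_norm (sqnorm_ge0 x)).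
  by rewrite -[X in _ * X](sqnormi x); exact: rdot_CS.
rewrite -ltNge in a0.
exists ((- complex.Re mu) ^+ 2) => [|x y /nS].
  by rewrite exprn_gt0 // oppr_gt0.
rewrite lecE => /andP[_]; rewrite /= -/(rdot _ _) => E.
apply: (@CS_lower_bound _ (rdot (y - mu *: x) x)) => //; rewrite ?sqnorm_ge0 //.
- by rewrite oppr_ge0 ltW.
- rewrite scale_complexE b0 !rdotE mul0r addr0 -/(sqnorm x).
  apply: le_trans (ler_norm _); lra.
- exact: rdot_CS.
Qed.

Lemma subspace_opshift T mu : subspace T -> subspace (opshift T mu).
Proof.
move=> [T0 TP]; split=> [|c [x y] [x' y'] h h'].
  by rewrite /opshift /= scaler0 addr0.
have := TP c _ _ h h'; rewrite /opshift /=; congr (T (_, _)) => /=.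
by rewrite !scalerDr addrACA !scalerA (mulrC c).
Qed.

Lemma closed_opshift T mu : closed T -> closed (opshift T mu).
Proof.
move=> cT; apply: sqnorm_closed => -[x y] h; apply: (closed_sqnorm cT) => e e0 /=.
set m := complex.Re mu ^+ 2 + complex.Im mu ^+ 2.
have m0 : 0 <= m by rewrite addr_ge0 ?sqr_ge0.
have [|[u v] [Tuv /= hu hv]] := h (e / (4 * m + 4)).
  by rewrite divr_gt0 // ltr_wpDl // mulr_ge0.
exists (u, v + mu *: u); split=> //=.
  apply: lt_le_trans hu _; rewrite ler_pdivrMr; last by lra.
  by rewrite ler_peMr ?(ltW e0) //; lra.
rewrite opprD addrACA -scalerBr.
apply: le_lt_trans (sqnormD_le _ _) _; rewrite sqnormZc -/m.
move: hu hv; rewrite !ltr_pdivlMr; try lra.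
have := sqnorm_ge0 (x - u); have := sqnorm_ge0 (y - v).
move: (sqnorm (x - u)) (sqnorm (y - v)) => a b a0 b0 ha hb.
have : 0 <= a * m by rewrite mulr_ge0.
have : 0 <= b * m by rewrite mulr_ge0.
lra.
Qed.

Lemma closed_range T (d : R) : closed T -> subspace T -> 0 < d ->
  (forall x y, T (x, y) -> d * sqnorm x <= sqnorm y) ->
  forall y, closure (ran T) y -> ran T y.
Proof.
move=> cT sT d0 low w /closure_sqnorm clw.
have /choice[p hp] : forall n : nat, exists p : H * H,
    T p /\ sqnorm (w - p.2) < n.+1%:R^-1.
  move=> n; have [|u [x Tx] hu] := clw n.+1%:R^-1; first by rewrite invr_gt0.
  by exists (x, u).
have [x hx] : exists l, forall e : R, 0 < e ->
     exists N, forall n, (N <= n)%N -> sqnorm ((p n).1 - l) < e.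
  apply: (@sqnorm_complete _ _ (fun n => (p n).1)) => e e0.
  have [|N hN] := @natSinv_small R (d * e / 4); first by rewrite divr_gt0 ?mulr_gt0.
  exists N => n m /hN hn /hN hm; rewrite -(ltr_pM2l d0).
  have [Tn wn] := hp n; have [Tm wm] := hp m.
  have := subspaceB sT Tn Tm; case: (p n) (p m) wn wm => [xn yn] [xm ym] /= wn wm.
  move=> /low; have := sqnorm_dist_le yn w ym.
  have := lt_trans wn hn; have := lt_trans wm hm.
  by rewrite (sqnormB yn w); lra.
exists x; apply: (closed_sqnorm cT) => e e0.
have [N1 h1] := hx e e0; have [N2 h2] := natSinv_small e0.
exists (p (maxn N1 N2)); have [Tp wp] := hp (maxn N1 N2); split=> //=.
  by rewrite sqnormB h1 // leq_maxl.
by apply: lt_trans wp _; rewrite h2 // leq_maxr.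
Qed.

(** The range of a closed operator that is bounded below is closed, so it is the
    whole space as soon as its orthogonal complement is trivial. *)
Lemma closed_range_onto T (d : R) : closed T -> subspace T -> 0 < d ->
  (forall x y, T (x, y) -> d * sqnorm x <= sqnorm y) ->
  (forall k, (forall y, ran T y -> '[k, y] = 0) -> k = 0) ->
  bounded_op (opinv T).
Proof.
move=> cT sT d0 low ort.
have onto h : ran T h.
  have [||y cly oy] := @projection_closure _ _ (ran T) _ _ h.
  - by exists 0; case: sT.
  - by move=> c y y' [x Tx] [x' Tx']; exists (c *: x + x'); exact: sT.2 c _ _ Tx Tx'.
  move/(closed_range cT sT d0 low): cly => [x Txy]; exists x.
  by rewrite -[h](subrK y) (ort _ oy) add0r.
have low0 x x' y : T (x, y) -> T (x', y) -> x = x'.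
  move=> Tx Tx'; have /low := subspaceB sT Tx Tx'.
  rewrite /= subrr sqnorm0 pmulr_rle0 // => h; apply/eqP.
  by rewrite -subr_eq0 -sqnorm_eq0 eq_le h sqnorm_ge0.
split.
- split=> [|c [y x] [y' x'] Tx Tx'|y x x']; first by case: sT.
    exact: sT.2 c _ _ Tx Tx'.
  exact: low0.
- by apply/seteqP; split=> // y _; have [x Tx] := onto y; exists x.
- exists (Num.sqrt d^-1) => y x /low; rewrite !norm_sqnorm -rmorphM lecR => h.
  rewrite -sqrtrM ?invr_ge0 ?(ltW d0) // ler_sqrt ?mulr_ge0 ?sqnorm_ge0 ?invr_ge0 ?(ltW d0) //.
  by rewrite -(ler_pM2l d0) mulrA mulfV ?mul1r // gt_eqF.
Qed.

(** A vector orthogonal to the range of [S - mu] is in the kernel of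
    [S - cconj mu], which is trivial by the same lower bound. *)
Lemma nonneg_selfadjoint_spectrum S : nonneg_selfadjoint S ->
  spectrum S `<=` [set mu | 0 <= mu].
Proof.
move=> [[[S0 SP Sf] dS aS] nS] mu hmu; apply: contrapT => /negP mu0.
apply: hmu; have cS : closed S by rewrite aS; exact: adjoint_closed.
have sS : subspace S by [].
have [d d0 low] := nonneg_lower_bound nS mu0.
apply: (@closed_range_onto _ d) => //.
- exact: closed_opshift.
- exact: subspace_opshift.
- by move=> x y /low /=; rewrite addrK.
move=> k ort; have mu'0 : ~~ (0 <= cconj mu) by rewrite /cconj conj_ge0.
have [d' d'0 low'] := nonneg_lower_bound nS mu'0.
suff /low' : S (k, cconj mu *: k).
  rewrite subrr sqnorm0 pmulr_rle0 // => h; apply/eqP.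
  by rewrite -sqnorm_eq0 eq_le h sqnorm_ge0.
rewrite aS => x y Sxy /=.
have : '[k, y - mu *: x] = 0.
  by apply: ort; exists x; rewrite /opshift /= subrK.
rewrite hdotDr hdotNr hdotZr => /eqP; rewrite subr_eq0 => /eqP E.
by rewrite hdotC E hdotZr cconjK [in RHS]hdotC /cconj rmorphM /= conjcK.
Qed.

Lemma selfadjoint_ran_ker S : selfadjoint S ->
  direct_sum_decomposition (closure (ran S)) (ker S).
Proof.
move=> [[S0 SP Sf] dS aS].
have ker_ort x y : ker S x -> ran S y -> '[y, x] = 0.
  by rewrite /ker /= {1}aS => Kx [u Suy]; have := Kx _ _ Suy; rewrite /= hdot0r.
have R0 : ran S 0 by exists 0.
split.
  apply/seteqP; split=> [x [/closure_sqnorm clx Kx]|x ->]; last first.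
    by split=> //; exact: subset_closure.
  rewrite /set1 /=; apply/eqP; rewrite -sqnorm_eq0; apply/eqP.
  rewrite /sqnorm (@rdot_limit _ _ x 0 x) ?rdot0r // => e /clx[y Ry hy].
  by exists y => //; rewrite rdot0r /rdot ker_ort.
move=> h; have [|a cla oa] := @projection_closure _ _ (ran S) R0 _ h.
  by move=> c y y' [x Tx] [x' Tx']; exists (c *: x + x'); exact: SP c _ _ Tx Tx'.
exists a, (h - a); split=> //; last by rewrite subrKC.
rewrite /ker /= aS => x y Sxy /=; rewrite hdot0r hdotC oa ?cconj0 //.
by exists x.
Qed.

Lemma direct_sum_transport f f' T : isomorphism f f' ->
  direct_sum_decomposition (closure (ran T)) (ker T) ->
  direct_sum_decomposition (closure (ran (transport f f T))) (ker (transport f f T)).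
Proof.
move=> [bf bf' fK f'K] [I D].
have kerE x : ker (transport f f T) x = ker T (f x).
  by rewrite /ker /transport /= (bl0 bf).
have ranE y : ran (transport f f T) y <-> ran T (f y).
  split=> -[x hx]; first by exists (f x).
  by exists (f' x); rewrite /transport /= f'K.
have clE y : closure (ran (transport f f T)) y <-> closure (ran T) (f y).
  have [M M0 hM] := bf.2; have [K K0 hK] := bf'.2.
  rewrite !closure_sqnorm; split=> h e e0.
    have [|z /ranE Rz hz] := h (e / M); first by rewrite divr_gt0.
    exists (f z) => //; rewrite -(blB _ _ bf).
    by apply: le_lt_trans (hM _) _; rewrite mulrC -ltr_pdivlMr.
  have [|z Rz hz] := h (e / K); first by rewrite divr_gt0.
  exists (f' z); first by apply/ranE; rewrite f'K.
  rewrite -[y]fK -(blB _ _ bf').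
  by apply: le_lt_trans (hK _) _; rewrite mulrC -ltr_pdivlMr.
split=> [|h].
  apply/seteqP; split=> [x [/clE clx]|x ->].
    rewrite kerE => Kx; have : (closure (ran T) `&` ker T) (f x) by [].
    by rewrite I /set1 /= => fx; rewrite -[x]fK fx (bl0 bf').
  rewrite /setI /= kerE clE (bl0 bf).
  by have : [set (0 : H)] 0 by []; rewrite -I.
have [a [b [Ra Kb E]]] := D (f h).
exists (f' a), (f' b); split; first by apply/clE; rewrite f'K.
  by rewrite kerE f'K.
by rewrite -(blD _ _ bf') -E fK.
Qed.

End SelfadjointSpectrum.

(** * Square roots of positive operators *)

Section SquareRoot.
Variables (R : realType) (H : hilbertType R).
Implicit Types (x y : H) (f g : H -> H).

(** Cauchy-Schwarz for the form [<f x, y>]. *)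
Lemma form_CS f : bounded_linear f -> symmetric_fun f ->
  (forall x, 0 <= rdot (f x) x) ->
  forall x y, rdot (f x) y ^+ 2 <= rdot (f x) x * rdot (f y) y.
Proof.
move=> bf sf pf x y; apply: quadratic_discr => // t.
have := pf (x + t%:C *: y); rewrite (blD _ _ bf) (blZ _ _ bf) !rdotE.
have -> : rdot (f y) x = rdot (f x) y.
  by rewrite [RHS]rdotC /rdot sf.
lra.
Qed.

(** Cauchy-Schwarz for the form of [f] at [x] and [f x]; the factor [M + 1] is a
    crude bound of [<f y, y>] by [|f y|^2 + |y|^2]. *)
Lemma nonneg_sqnorm_le f (M : R) : 0 < M -> bounded_linear f -> symmetric_fun f ->
  (forall x, 0 <= rdot (f x) x) -> (forall x, sqnorm (f x) <= M * sqnorm x) ->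
  forall x, sqnorm (f x) <= (M + 1) * rdot (f x) x.
Proof.
move=> M0 bf sf pf hM x.
have := sqnorm_ge0 (f x); rewrite le0r => /predU1P[->|s0].
  by rewrite mulr_ge0 // addr_ge0 // ltW.
have := form_CS bf sf pf x (f x); rewrite -/(sqnorm _) => h.
rewrite -(ler_pM2r s0) -expr2; apply: le_trans h _.
rewrite [leRHS]mulrAC [leRHS]mulrC ler_wpM2l //.
have := hM (f x); have := sqnorm_ge0 (f (f x) - f x).
rewrite /sqnorm !rdotE (rdotC (f x) (f (f x))) => h1 h2.
have := ler_wpM2r (ltW s0) (ltW M0); rewrite mul0r /sqnorm; lra.
Qed.

(** Boundedness of the inverse of [f] turns the bound of [|f x|^2] by the form into
    a bound of [|x|^2]. *)
Lemma coercive f g : isomorphism f g -> symmetric_fun f ->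
  (forall x, 0 <= rdot (f x) x) ->
  exists2 c : R, 0 < c & forall x, c * sqnorm x <= rdot (f x) x.
Proof.
move=> [bf bg fK _] sf pf; have [M M0 hM] := bf.2; have [K K0 hK] := bg.2.
have M1 : 0 < M + 1 by rewrite addr_gt0.
exists (K * (M + 1))^-1; first by rewrite invr_gt0 mulr_gt0.
move=> x; rewrite -[x in leLHS]fK ler_pdivrMl ?mulr_gt0 //.
apply: le_trans (hK _) _; rewrite -mulrA ler_pM2l //.
exact: nonneg_sqnorm_le.
Qed.

Lemma geometric_small (q e : R) : 0 < q < 1 -> 0 < e ->
  exists N, forall n, (N <= n)%N -> q ^+ n < e.
Proof.
move=> /andP[q0 q1] e0.
have /cvgrPdist_lt /(_ e e0)[N _ hN] : q ^+ n @[n --> \oo] --> 0.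
  by apply: cvg_expr; rewrite ger0_norm // ltW.
exists N => n /hN /=; rewrite sub0r normrN ger0_norm //.
by rewrite exprn_ge0 // ltW.
Qed.

Lemma geometric_eq0 (q a C : R) : 0 < q < 1 -> 0 <= a ->
  (forall n, a <= C * q ^+ n) -> a = 0.
Proof.
move=> q01 a0 h; apply: (@small_eq0 _ _ `|C|) => // e e0.
have [N /(_ N (leqnn N)) hN] := geometric_small q01 e0.
apply: le_trans (h N) _; rewrite mulrC.
apply: (@le_trans _ _ (q ^+ N * `|C|)); last by rewrite ler_wpM2r // ltW.
by rewrite ler_wpM2l ?ler_norm // exprn_ge0 // ltW //; case/andP: q01.
Qed.

(** The constant depends only on the ratio, which is what makes pointwise limits
    of operators bounded. *)
Lemma geometric_limit (q : R) : 0 < q < 1 -> exists2 K : R, 0 < K &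
  forall (u : nat -> H) (C : R), 0 <= C ->
  (forall n, sqnorm (u n.+1 - u n) <= C * q ^+ n) ->
  exists l, forall n, sqnorm (u n - l) <= K * C * q ^+ n.
Proof.
move=> q01; have /andP[q0 q1] := q01.
(* Young's inequality with a weight s such that (1 + s) q < 1 makes the sum of the
   increments contract; K is the fixed point of the resulting recursion. *)
pose s := (1 - q) / 2; pose K := (1 + s^-1) / ((1 - q) * (1 - q / 2)).
have s0 : 0 < s by rewrite divr_gt0 // subr_gt0.
have q2 : 0 < 1 - q / 2 by lra.
have q3 : 0 < 1 - q by lra.
have K0 : 0 < K by rewrite !divr_gt0 ?mulr_gt0 // addr_gt0 // invr_gt0.
have q0' := ltW q0; have K0' := ltW K0.
have KE : (1 + s) * q * K + (1 + s^-1) = K.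
  by rewrite /K /s; field; rewrite !gt_eqF // -?mulr2n; lra.
clearbody K.
exists (4 * K) => [|u C C0 hu]; first by rewrite mulr_gt0.
have wD x y : sqnorm (x + y) <= (1 + s) * sqnorm x + (1 + s^-1) * sqnorm y.
  have := sqnorm_ge0 (s%:C *: x - y); rewrite -(@pmulr_rge0 _ s^-1) ?invr_gt0 //.
  rewrite /sqnorm !rdotE (rdotC y x).
  set a := rdot x x; set b := rdot x y; set c := rdot y y.
  rewrite (_ : s^-1 * _ = s * a - 2 * b + s^-1 * c); last first.
    by field; rewrite gt_eqF.
  lra.
have P m : forall n, sqnorm (u (n + m)%N - u n) <= K * C * q ^+ n.
  elim: m => [|m IH] n.
    by rewrite addn0 subrr sqnorm0 mulr_ge0 ?exprn_ge0 ?mulr_ge0.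
  rewrite -(subrKA (u n.+1)) addnS -addSn; apply: le_trans (wD _ _) _.
  have h1 := ler_wpM2l (addr_ge0 ler01 (ltW s0)) (IH n.+1).
  have si : 0 <= s^-1 by rewrite invr_ge0 ltW.
  have h2 := ler_wpM2l (addr_ge0 ler01 si) (hu n).
  apply: le_trans (lerD h1 h2) _.
  rewrite -[in leRHS]KE exprS; set t := q ^+ n; lra.
have [l hl] : exists l, forall e : R, 0 < e ->
     exists N, forall n, (N <= n)%N -> sqnorm (u n - l) < e.
  apply: sqnorm_complete => e e0.
  have [|N hN] := @geometric_small q (e / (4 * K * C + 1)) q01.
    by rewrite divr_gt0 // ltr_wpDl // !mulr_ge0 // ltW.
  have A : 4 * K * C * q ^+ N < e.
    have := hN N (leqnn N); rewrite ltr_pdivlMr; last first.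
      by rewrite ltr_wpDl // !mulr_ge0 // ltW.
    have : 0 < q ^+ N by rewrite exprn_gt0.
    lra.
  exists N => n m Nn Nm.
  have := P (n - N)%N N; have := P (m - N)%N N; rewrite !subnKC // => hm hn.
  apply: le_lt_trans (sqnorm_dist_le _ (u N) _) _.
  rewrite (sqnormB (u N)); lra.
exists l => n.
have KC : 0 <= K * C * q ^+ n by rewrite mulr_ge0 ?exprn_ge0 ?mulr_ge0.
apply/ler_addgt0Pr => e e0; have [|N hN] := hl (e / 2); first by rewrite divr_gt0.
apply: le_trans (sqnorm_dist_le _ (u (n + N)%N) _) _.
have := hN _ (leq_addl n N); have := P N n; rewrite (sqnormB (u n)).
lra.
Qed.

Lemma sqnorm_half_le x y :
  sqnorm ((2^-1)%:C *: (x + y)) <= (sqnorm x + sqnorm y) / 2.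
Proof. by rewrite sqnormZ; have := sqnormD_le x y; lra. Qed.

(** The fixed point of [Y = (A + Y^2) / 2], which says that [(1 - Y)^2 = 1 - A].
    All iterates from 0 commute, being polynomials in [A], so three consecutive ones
    satisfy [Y'' - Y' = (Y' + Y) (Y' - Y) / 2], and the bound [|Y x|^2 <= q |x|^2]
    makes the iteration contract. *)
Lemma contraction_fixpoint (A : H -> H) (q : R) : 0 < q < 1 ->
  bounded_linear A -> symmetric_fun A ->
  (forall x, sqnorm (A x) <= q * sqnorm x) ->
  exists Y, [/\ bounded_linear Y, symmetric_fun Y &
    forall x, Y (Y x) = Y x + Y x - A x].
Proof.
move=> q01 bA sA hA; have /andP[q0 q1] := q01.
pose Yn n := iter n (fun (Y : H -> H) x => (2^-1)%:C *: (A x + Y (Y x))) (fun=> 0).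
have Y0 x : Yn 0%N x = 0 by [].
have YS n x : Yn n.+1 x = (2^-1)%:C *: (A x + Yn n (Yn n x)) by [].
have bY n : bounded_linear (Yn n).
  elim: n => [|n IH]; last first.
    apply: (@bounded_linearZ _ _ (fun x => A x + Yn n (Yn n x))).
    apply: bounded_linearD => //.
    exact: bounded_linear_comp.
  split=> [c x y|]; first by rewrite !Y0 scaler0 addr0.
  by exists 1 => // x; rewrite Y0 sqnorm0 mul1r sqnorm_ge0.
clearbody Yn.
have symY n x y : rdot (Yn n x) y = rdot x (Yn n y).
  elim: n x y => [|n IH] x y; first by rewrite !Y0 !rdotE.
  by rewrite !YS !rdotE !IH /rdot sA.
have cY n g : bounded_linear g -> (forall x, A (g x) = g (A x)) ->
    forall x, Yn n (g x) = g (Yn n x).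
  move=> bg cg; elim: n => [|n IH] x; first by rewrite !Y0 (bl0 bg).
  by rewrite !YS cg !IH -(blD _ _ bg) -(blZ _ _ bg).
have cYY n m x : Yn n (Yn m x) = Yn m (Yn n x).
  by apply: (cY n) => // y; rewrite (cY m A bA).
have qY n x : sqnorm (Yn n x) <= q * sqnorm x.
  elim: n x => [|n IH] x; first by rewrite Y0 sqnorm0 mulr_ge0 ?sqnorm_ge0 // ltW.
  rewrite YS; apply: le_trans (sqnorm_half_le _ _) _.
  have h1 := hA x; have h2 := IH (Yn n x); have h3 := IH x.
  have h4 := ler_wpM2l (ltW q0) h3.
  have h5 : q * (q * sqnorm x) <= q * sqnorm x.
    by rewrite ler_pM2l // ler_piMl ?sqnorm_ge0 // ltW.
  lra.
have dY n x : sqnorm (Yn n.+1 x - Yn n x) <= sqnorm x * q ^+ n.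
  elim: n x => [|n IH] x.
    rewrite expr0 mulr1 YS !Y0 subr0; apply: le_trans (sqnorm_half_le _ _) _.
    rewrite sqnorm0; have := hA x.
    have := ler_wpM2r (sqnorm_ge0 x) (ltW q1); have := sqnorm_ge0 x; lra.
  have -> : Yn n.+2 x - Yn n.+1 x = (2^-1)%:C *:
      (Yn n.+1 (Yn n.+1 x - Yn n x) + Yn n (Yn n.+1 x - Yn n x)).
    rewrite YS (blB _ _ (bY n.+1)) (blB _ _ (bY n)) [X in _ - X]YS.
    rewrite -scalerBr opprD addrACA subrr add0r; congr (_ *: _).
    by rewrite (cYY n.+1 n) subrKA.
  apply: le_trans (sqnorm_half_le _ _) _.
  have h1 := qY n.+1 (Yn n.+1 x - Yn n x); have h2 := qY n (Yn n.+1 x - Yn n x).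
  have h3 := ler_wpM2l (ltW q0) (IH x).
  rewrite exprS; lra.
have [K K0 hK] := geometric_limit q01.
have /choice[Y hY] : forall x, exists l, forall n,
    sqnorm (Yn n x - l) <= K * sqnorm x * q ^+ n.
  move=> x; apply: (hK (fun n => Yn n x)); first exact: sqnorm_ge0.
  by move=> n; exact: dY.
have eqY (a b : H) C : (forall n, sqnorm (a - b) <= C * q ^+ n) -> a = b.
  move=> h; apply/eqP; rewrite -subr_eq0 -sqnorm_eq0; apply/eqP.
  by apply: geometric_eq0 h; rewrite ?sqnorm_ge0.
have lY (c : R[i]) x y : Y (c *: x + y) = c *: Y x + Y y.
  set m := complex.Re c ^+ 2 + complex.Im c ^+ 2.
  have m0 : 0 <= m by rewrite addr_ge0 ?sqr_ge0.
  refine (eqY _ _ (2 * (K * sqnorm (c *: x + y)) +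
     2 * (2 * m * (K * sqnorm x) + 2 * (K * sqnorm y))) _) => n.
  have -> : Y (c *: x + y) - (c *: Y x + Y y) =
     - (Yn n (c *: x + y) - Y (c *: x + y)) + (c *: (Yn n x - Y x) + (Yn n y - Y y)).
    by rewrite opprB scalerBr [X in _ = _ + X]addrACA -opprD (bY n).1 subrKA.
  apply: le_trans (sqnormD_le _ _) _; rewrite sqnormN.
  have h := sqnormD_le (c *: (Yn n x - Y x)) (Yn n y - Y y).
  rewrite sqnormZc -/m in h.
  have h1 := hY (c *: x + y) n; have h2 := ler_wpM2l m0 (hY x n); have h3 := hY y n.
  move: h h1 h2 h3; set t := q ^+ n; lra.
have bdY : bounded_linear Y.
  split; first exact: lY.
  exists K => // x; have := hY x 0; rewrite expr0 mulr1 Y0.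
  by rewrite sub0r sqnormN.
have sY : symmetric_fun Y.
  apply: symmetric_funP => // x y.
  apply/eqP; rewrite -subr_eq0 -sqrf_eq0; apply/eqP.
  apply: (@geometric_eq0 q _ (4 * K * (sqnorm x * sqnorm y))) => // [|n].
    exact: sqr_ge0.
  have h1 := rdot_CS (Yn n x - Y x) y; have h2 := rdot_CS x (Yn n y - Y y).
  have h3 := ler_wpM2r (sqnorm_ge0 y) (hY x n).
  have h4 := ler_wpM2l (sqnorm_ge0 x) (hY y n).
  have -> : rdot (Y x) y - rdot x (Y y) =
      rdot x (Yn n y - Y y) - rdot (Yn n x - Y x) y.
    by rewrite !rdotE symY; lra.
  have := sqr_ge0 (rdot x (Yn n y - Y y) + rdot (Yn n x - Y x) y).
  move: h1 h2 h3 h4; set t := q ^+ n; lra.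
exists Y; split=> // x.
suff h : Y x = (2^-1)%:C *: (A x + Y (Y x)).
  have : Y x + Y x = A x + Y (Y x).
    rewrite {1 2}h -scalerDl -rmorphD /= (_ : 2^-1 + 2^-1 = 1 :> R) ?scale1r //.
    by field.
  by move=> ->; rewrite addrAC subrr add0r.
apply: (eqY _ _ (2 * (K * sqnorm x) + (K * sqnorm (Y x) + q * (K * sqnorm x)))) => n.
have -> : Y x - (2^-1)%:C *: (A x + Y (Y x)) =
    - (Yn n.+1 x - Y x) + (2^-1)%:C *: (Yn n (Yn n x - Y x) + (Yn n (Y x) - Y (Y x))).
  rewrite opprB (blB _ _ (bY n)) subrKA.
  rewrite -[LHS](subrKA (Yn n.+1 x)); congr (_ + _).
  by rewrite YS -scalerBr opprD addrACA subrr add0r.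
apply: le_trans (sqnormD_le _ _) _; rewrite sqnormN.
have h1 := hY x n.+1; have h2 := hY (Y x) n.
have h3 := qY n (Yn n x - Y x); have h4 := ler_wpM2l (ltW q0) (hY x n).
have h5 := sqnorm_half_le (Yn n (Yn n x - Y x)) (Yn n (Y x) - Y (Y x)).
have h6 : K * sqnorm x * q ^+ n.+1 <= K * sqnorm x * q ^+ n.
  rewrite exprS ler_wpM2l ?mulr_ge0 ?sqnorm_ge0 ?(ltW K0) //.
  by rewrite ler_piMl ?exprn_ge0 ?ltW.
move: h1 h2 h3 h4 h5 h6; set t := q ^+ n; set t' := q ^+ n.+1; lra.
Qed.

(** [|x - t f x|^2 <= (1 - 2 t c + t^2 M) |x|^2] with [c] the coercivity constant
    and [M] the bound of [f]; a suitable [t] makes the factor less than 1. *)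
Lemma square_root f g : isomorphism f g -> symmetric_fun f ->
  (forall x, 0 <= rdot (f x) x) ->
  exists r r', [/\ isomorphism r r', symmetric_fun r & forall x, r (r x) = f x].
Proof.
move=> iso sf pf; have [bf bg fK gK] := iso.
have [c c0 hc] := coercive iso sf pf; have [M M0 hM] := bf.2.
(* M is enlarged to N so that the ratio q is positive *)
pose N := M + c ^+ 2; pose t := c / N; pose q := 1 - c ^+ 2 / N.
have cc : 0 < c ^+ 2 by rewrite exprn_gt0.
have N0 : 0 < N by rewrite addr_gt0.
have t0 : 0 < t by rewrite divr_gt0.
have q01 : 0 < q < 1.
  rewrite /q subr_gt0 ltr_pdivrMr // mul1r ltrDr M0 /=.
  by rewrite gtrBl divr_gt0.
pose A x := x + (- t)%:C *: f x.
have bA : bounded_linear A.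
  apply: (bounded_linearD (@bounded_linear_id R H)); exact: bounded_linearZ.
have sA : symmetric_fun A.
  by apply: symmetric_funP => // x y; rewrite /A !rdotE /rdot sf.
have hA x : sqnorm (A x) <= q * sqnorm x.
  have -> : sqnorm (A x) = sqnorm x - 2 * t * rdot (f x) x + t ^+ 2 * sqnorm (f x).
    rewrite /A /sqnorm !rdotE (rdotC x (f x)); lra.
  have h1 := ler_wpM2l (ltW t0) (hc x); have h2 := ler_wpM2l (sqr_ge0 t) (hM x).
  have E1 : t * c = c ^+ 2 / N by rewrite /t; ring.
  have E2 : t ^+ 2 * M <= c ^+ 2 / N.
    have -> : t ^+ 2 * M = c ^+ 2 / N * (M / N) by rewrite /t; field; rewrite gt_eqF.
    by rewrite ler_piMr ?divr_ge0 ?(ltW N0) ?(ltW cc) // ler_pdivrMr // mul1r lerDl ltW.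
  have h3 := ler_wpM2r (sqnorm_ge0 x) E2.
  rewrite mulrA E1 in h1; rewrite mulrA in h2.
  have ar (t' s k z F M' : R) : k * s <= t' * z -> t' ^+ 2 * F <= t' ^+ 2 * M' * s ->
      t' ^+ 2 * M' * s <= k * s -> s - 2 * t' * z + t' ^+ 2 * F <= (1 - k) * s by lra.
  exact: ar h1 h2 h3.
have [Y [bY sY hY]] := contraction_fixpoint q01 bA sA hA.
pose s := (Num.sqrt t)^-1.
pose r x := s%:C *: (x + (-1)%:C *: Y x).
have br : bounded_linear r.
  apply: bounded_linearZ; apply: (bounded_linearD (@bounded_linear_id R H)).
  exact: bounded_linearZ.
have ss : s * s * t = 1.
  by rewrite -expr2 /s exprVn sqr_sqrtr ?ltW // mulVf // gt_eqF.
have rr x : r (r x) = f x.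
  have rE z : r z = s%:C *: (z - Y z) by rewrite /r rmorphN1 scaleN1r.
  rewrite {1}rE [X in _ - X](_ : _ = s%:C *: (Y x - Y (Y x))); last first.
    by rewrite rE (blZ _ _ bY) (blB _ _ bY).
  rewrite rE -scalerBr hY.
  have -> : x - Y x - (Y x - (Y x + Y x - A x)) = t%:C *: f x.
    have -> : x - Y x - (Y x - (Y x + Y x - A x)) = x - A x.
      by rewrite opprB [X in _ + X]addrAC addrK subrKA.
    by rewrite /A opprD addrA subrr add0r rmorphN scaleNr opprK.
  by rewrite !scalerA -!rmorphM /= ss scale1r.
have sr : symmetric_fun r.
  by apply: symmetric_funP => // x y; rewrite /r !rdotE /rdot sY.
exists r, (g \o r); split=> //; split=> //.
- exact: bounded_linear_comp.
- by move=> x; rewrite /= rr fK.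
- have rg z : r (g z) = g (r z) by rewrite -{2}(gK z) -(rr (g z)) rr fK.
  by move=> x; rewrite /= rg rr fK.
Qed.

End SquareRoot.

(** * Joint approximate eigenvectors *)

Section ApproximateSpectrum.
Variables (R : realType) (H : hilbertType R).
Implicit Types (x y : H) (f g K Q B : H -> H).

(** On the approximate kernel of [K], the symmetric operator [Q], which commutes
    with [K], has an approximate eigenvalue: the greatest value [l] that its form
    takes there. The approximate kernel is not a subspace, and [l] is defined by
    penalization, as the infimum of the [t] such that [Q <= t + C K^* K] for some
    [C]. A vector [x] at which the form of [L = l + e - Q + 2 C K^* K] is small is
    an approximate eigenvector: Cauchy-Schwarz for this form at [x] and
    [y = (l - Q) x] bounds [|y|^2], and [C] may be large since [K y = (l - Q) K x]
    is controlled by [K x], for which [C |K x|^2 <= 2 e |x|^2]. With [K = 0] this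
    says that the top of the numerical range is an approximate eigenvalue. *)
Lemma approx_top K Q : bounded_linear K -> bounded_linear Q -> symmetric_fun Q ->
  (forall x, K (Q x) = Q (K x)) ->
  (forall e : R, 0 < e -> exists2 x, x != 0 & sqnorm (K x) <= e * sqnorm x) ->
  exists l : R,
    (forall e : R, 0 < e -> exists2 C : R, 0 <= C &
       forall x, rdot (Q x) x <= (l + e) * sqnorm x + C * sqnorm (K x)) /\
    (forall e : R, 0 < e -> exists x, [/\ x != 0, sqnorm (K x) <= e * sqnorm x &
       sqnorm (Q x - l%:C *: x) <= e * sqnorm x]).
Proof.
move=> bK bQ sQ cKQ null; have [M M0 hM] := bQ.2.
have Qle x : `|rdot (Q x) x| <= (M + 1) / 2 * sqnorm x.
  rewrite ler_norml; have := sqnorm_ge0 (Q x - x); have := sqnorm_ge0 (Q x + x).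
  have := hM x; rewrite /sqnorm !rdotE (rdotC x (Q x)) => h1 h2 h3.
  by apply/andP; split; lra.
(* the penalized upper bounds of Q *)
pose L := [set l : R | exists2 C : R, 0 <= C &
   forall x, rdot (Q x) x <= l * sqnorm x + C * sqnorm (K x)].
have L0 : L ((M + 1) / 2).
  exists 0 => // x; rewrite mul0r addr0.
  by have := Qle x; rewrite ler_norml => /andP[].
have Llb : lbound L (- ((M + 1) / 2) - 1).
  move=> l [C C0 hC].
  have C1 : 0 < C + 1 by rewrite ltr_wpDl.
  have [|x x0 hx] := null (C + 1)^-1; first by rewrite invr_gt0.
  rewrite -sqnorm_gt0 in x0; rewrite -(ler_pM2r x0).
  have := Qle x; rewrite ler_norml => /andP[h1 _]; have h2 := hC x.
  have : (C + 1) * sqnorm (K x) <= sqnorm x.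
    by rewrite -(ler_pdivlMl _ _ C1).
  have := sqnorm_ge0 (K x); lra.
have hL : has_inf L by split; [exists ((M + 1) / 2) | exists (- ((M + 1) / 2) - 1)].
pose l := inf L.
have Lup e : 0 < e -> exists2 C : R, 0 <= C &
    forall x, rdot (Q x) x <= (l + e) * sqnorm x + C * sqnorm (K x).
  move=> e0; have [l' [C C0 hC] hl] := inf_adherent e0 hL.
  exists C => // x; apply: le_trans (hC x) _; rewrite lerD2r.
  by rewrite ler_wpM2r ?sqnorm_ge0 // ltW.
exists l; split=> // eta eta0.
pose m := 2 * l ^+ 2 + 2 * M.
have m0 : 0 < m by have := sqr_ge0 l; rewrite /m; lra.
pose W := m * (`|l| + 1 + (M + 1) / 2 + 4).
have W0 : 0 < W by apply: mulr_gt0 => //; have := normr_ge0 l; lra.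
pose e := Num.min 1 (Num.min (eta / (6 * (1 + m))) (eta ^+ 2 / (8 * W))).
have m1 : 0 < 6 * (1 + m) by lra.
have W8 : 0 < 8 * W by lra.
have e0 : 0 < e by rewrite !lt_min ltr01 !divr_gt0 ?exprn_gt0.
have e1 : e <= 1 by rewrite ge_min lexx.
have e2 : e * (6 * (1 + m)) <= eta.
  by rewrite -ler_pdivlMr // /e !ge_min lexx ?orbT.
have e3 : e * (8 * W) <= eta ^+ 2.
  by rewrite -ler_pdivlMr // /e !ge_min lexx ?orbT.
clearbody e.
have [C' C'0 hC'] := Lup e e0; pose C := C' + 1.
have C1 : 1 <= C by rewrite lerDr.
have hC x : rdot (Q x) x <= (l + e) * sqnorm x + C * sqnorm (K x).
  apply: le_trans (hC' x) _; rewrite lerD2l ler_wpM2r ?sqnorm_ge0 //.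
  by rewrite lerDl.
(* l - e is below the infimum, so it is not a bound even with the constant 2 C *)
have [x hx] : exists x, (l - e) * sqnorm x + 2 * C * sqnorm (K x) < rdot (Q x) x.
  apply: contrapT => /forallNP h.
  have : L (l - e).
    exists (2 * C) => [|x]; first by rewrite mulr_ge0 // (le_trans ler01).
    by rewrite leNgt; apply/negP.
  by move/(ge_inf hL.2); rewrite -/l; lra.
have x0 : x != 0.
  apply: contraTN hx => /eqP ->.
  by rewrite (bl0 bK) (bl0 bQ) rdot0l !sqnorm0 !mulr0 addr0 ltxx.
have s0 : 0 < sqnorm x by rewrite sqnorm_gt0.
(* the form of L, and below its polarization b at x and y *)
pose q y := (l + e) * sqnorm y - rdot (Q y) y + 2 * C * sqnorm (K y).
have q0 y : 0 <= q y.
  have := hC y; have := sqnorm_ge0 (K y); rewrite /q; nra.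
have Kx : C * sqnorm (K x) <= 2 * e * sqnorm x.
  have := hC x; lra.
have Kx1 : sqnorm (K x) <= 2 * e * sqnorm x.
  by apply: le_trans Kx; rewrite ler_peMl ?sqnorm_ge0.
have [y yE] : exists y, y = l%:C *: x - Q x by exists (l%:C *: x - Q x).
have yle z : sqnorm (l%:C *: z - Q z) <= m * sqnorm z.
  apply: le_trans (sqnormD_le _ _) _; rewrite sqnormN sqnormZ.
  have := hM z; rewrite /m; lra.
have Ky : K y = l%:C *: K x - Q (K x) by rewrite yE (blB _ _ bK) (blZ _ _ bK) cKQ.
pose b := (l + e) * rdot x y - rdot (Q x) y + 2 * C * rdot (K x) (K y).
have bq : b ^+ 2 <= q x * q y.
  apply: quadratic_discr => // t; have := q0 (x + t%:C *: y).
  rewrite /q (blD _ _ bK) (blD _ _ bQ) (blZ _ _ bK) (blZ _ _ bQ) /b.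
  rewrite /sqnorm !rdotE (rdotC y x) (rdotC (K y) (K x)).
  have -> : rdot (Q y) x = rdot (Q x) y by rewrite [RHS]rdotC /rdot sQ.
  lra.
exists x; split=> //; first by apply: le_trans Kx1 _; rewrite ler_wpM2r ?ltW //; nra.
rewrite sqnormB -yE.
have ym := yle x; rewrite -yE in ym.
have Kym : C * sqnorm (K y) <= m * (2 * e * sqnorm x).
  have := yle (K x); rewrite -Ky => h.
  apply: le_trans (ler_wpM2l (ltW m0) Kx); rewrite mulrCA ler_wpM2l //.
  exact: le_trans C1.
have qx : q x <= 2 * e * sqnorm x by rewrite /q; lra.
have qy : q y <= W * sqnorm x.
  have := Qle y; rewrite ler_norml => /andP[h1 _].
  have h2 := ler_norm l.
  have h3 : (l + e) * sqnorm y <= (`|l| + 1) * sqnorm y.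
    by rewrite ler_wpM2r ?sqnorm_ge0 // lerD.
  have k0 : 0 <= `|l| + 1 + (M + 1) / 2 by have := normr_ge0 l; lra.
  have h4 := ler_wpM2l k0 ym.
  have h5 : m * (2 * e * sqnorm x) <= m * (2 * sqnorm x).
    by rewrite ler_pM2l // ler_pM2r //; lra.
  rewrite /q /W; move: h1 h3 h4 h5 Kym; lra.
have beta : b <= eta / 2 * sqnorm x.
  have h : b ^+ 2 <= (eta / 2 * sqnorm x) ^+ 2.
    apply: le_trans bq _.
    apply: le_trans (ler_pM (q0 x) (q0 y) qx qy) _.
    have := ler_wpM2r (sqr_ge0 (sqnorm x)) e3; lra.
  have E0 : 0 <= eta / 2 * sqnorm x by rewrite mulr_ge0 ?divr_ge0 // ltW.
  rewrite (le_trans (ler_norm b)) // -(@ler_pXn2r _ 2) ?nnegrE //.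
  by rewrite real_normK ?num_real.
have bE : b = sqnorm y + e * rdot x y + 2 * C * rdot (K x) (K y).
  rewrite /b (_ : sqnorm y = l * rdot x y - rdot (Q x) y); first by lra.
  by rewrite /sqnorm {1}yE rdotBl rdotZl.
have h1 : - (sqnorm x + sqnorm y) <= 2 * rdot x y.
  have := sqnorm_ge0 (x + y); rewrite /sqnorm !rdotE (rdotC y x); lra.
have h2 : - (sqnorm (K x) + sqnorm (K y)) <= 2 * rdot (K x) (K y).
  have := sqnorm_ge0 (K x + K y); rewrite /sqnorm !rdotE (rdotC (K y) (K x)); lra.
have h3 := ler_wpM2l (ltW e0) h1.
have h4 := ler_wpM2l (le_trans ler01 C1) h2.
have h5 := ler_wpM2l (ltW e0) ym.
have h6 := ler_wpM2r (ltW s0) e2.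
have h7 := mulr_ge0 (ltW eta0) (ltW s0).
rewrite bE in beta; move: beta h3 h4 h5 h6 h7 Kx Kym; lra.
Qed.

End ApproximateSpectrum.

(** * Numerical range and cores *)

Section NormalOperators.
Variables (R : realType) (H : hilbertType R).
Implicit Types (x y : H) (f g A B : H -> H) (T : set (H * H)).

Lemma scale_iB x y : 'i *: (x - y) = 'i *: x - 'i *: y.
Proof. exact: scalerBr. Qed.

(** For [B = P + i Q] normal, the top [s] of the form of [P] and the value [l] given
    by [approx_top] for [K = P - s] and [Q] make [s + i l] an approximate eigenvalue
    of [B], which is excluded when [s > c]. *)
Lemma numerical_range_le B B' (c : R) :
  bounded_linear B -> adjoint_fun B B' -> (forall x, B (B' x) = B' (B x)) ->
  (forall z : R[i], c < complex.Re z ->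
     exists2 d : R, 0 < d & forall x, d * sqnorm x <= sqnorm (B x - z *: x)) ->
  forall x, rdot (B x) x <= c * sqnorm x.
Proof.
move=> bB aB comm low x0; rewrite leNgt; apply/negP => hx0.
have bB' := adjoint_fun_bounded bB aB.
have aB' := adjoint_fun_sym aB.
pose P x := (2^-1)%:C *: (B x + B' x).
pose Q x := (2^-1)%:C *: ('i *: (B' x - B x)).
have bP : bounded_linear P.
  by apply: bounded_linearZ; exact: bounded_linearD.
have bQ : bounded_linear Q.
  apply: (@bounded_linearZ _ _ (fun x => 'i *: (B' x - B x))).
  apply: (@bounded_linearZ _ _ (fun x => B' x - B x)).
  have := bounded_linearD bB' (bounded_linearZ (-1) bB).
  by congr bounded_linear; apply: funext => x; rewrite scaleN1r.
have raB x y : rdot (B x) y = rdot x (B' y) by rewrite /rdot aB.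
have raB' x y : rdot (B' x) y = rdot x (B y) by rewrite /rdot aB'.
have sP : symmetric_fun P.
  by apply: symmetric_funP => // x y; rewrite /P !rdotE raB raB'; lra.
have sQ : symmetric_fun Q.
  apply: symmetric_funP => // x y; rewrite /Q rdotZl rdotZr rdotiC scale_iB.
  by rewrite rdotBl rdotBr raB raB' (blZ _ _ bB) (blZ _ _ bB') opprB.
have BQ x : B (Q x) = Q (B x).
  by rewrite /Q (blZ _ _ bB) (blZ _ _ bB) (blB _ _ bB) comm.
have B'Q x : B' (Q x) = Q (B' x).
  by rewrite /Q (blZ _ _ bB') (blZ _ _ bB') (blB _ _ bB') comm.
have PQ x : P (Q x) = Q (P x).
  by rewrite /P BQ B'Q -(blD _ _ bQ) -(blZ _ _ bQ).
have BE x : B x = P x + 'i *: Q x.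
  have E : 'i * (2^-1 : R)%:C * 'i = - (2^-1)%:C by rewrite mulrAC -expr2 sqr_i mulN1r.
  rewrite /P /Q !scalerA E scaleNr -scalerBr opprB addrACA subrr addr0.
  by rewrite scalerDr -scalerDl -rmorphD /= (_ : 2^-1 + 2^-1 = 1 :> R) ?scale1r //; field.
have x00 : x0 != 0.
  apply: contraTN hx0 => /eqP ->; rewrite (bl0 bB) rdot0l sqnorm0 mulr0 ltxx //.
have s0 : 0 < sqnorm x0 by rewrite sqnorm_gt0.
have bl00 : bounded_linear (fun=> 0 : H).
  split=> [k x y|]; first by rewrite scaler0 addr0.
  by exists 1 => // x; rewrite sqnorm0 mul1r sqnorm_ge0.
have [||s [top nulls]] := approx_top bl00 bP sP.
- by move=> x; rewrite (bl0 bP).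
- by move=> e e0; exists x0 => //; rewrite sqnorm0 mulr_ge0 // ltW.
have cs : c < s.
  rewrite ltNge; apply/negP => sc.
  pose e := (rdot (B x0) x0 - c * sqnorm x0) / sqnorm x0 / 2.
  have e0 : 0 < e by rewrite !divr_gt0 // subr_gt0.
  have [C C0 /(_ x0)] := top e e0; rewrite sqnorm0 mulr0 addr0.
  have -> : rdot (P x0) x0 = rdot (B x0) x0.
    by rewrite /P !rdotE (rdotC (B' x0)) -raB; lra.
  have E : e * sqnorm x0 * 2 = rdot (B x0) x0 - c * sqnorm x0.
    by rewrite /e; field; rewrite gt_eqF.
  have := ler_wpM2r (ltW s0) sc; rewrite mulrDl; lra.
pose K x := P x + (- s)%:C *: x.
have bK : bounded_linear K.
  by apply: bounded_linearD => //; exact/bounded_linearZ/bounded_linear_id.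
have [||l [_ nulll]] := approx_top bK bQ sQ.
- by move=> x; rewrite /K PQ (blD _ _ bQ) (blZ _ _ bQ).
- move=> e /nulls[x [xn0 _ hx]]; exists x => //.
  by rewrite /K rmorphN scaleNr.
have [d d0 lowd] := low (s +i* l) cs.
have [|x [xn0 hK hQ]] := nulll (d / 5); first by rewrite divr_gt0.
have sx : 0 < sqnorm x by rewrite sqnorm_gt0.
have : sqnorm (B x - (s +i* l) *: x) <= 2 * sqnorm (K x) + 2 * sqnorm (Q x - l%:C *: x).
  rewrite -[X in _ <= _ + 2 * X]sqnormi; apply: le_trans (sqnormD_le _ _).
  rewrite le_eqVlt; apply/orP; left; apply/eqP; congr sqnorm.
  rewrite BE [in LHS]scale_complexE /= /K rmorphN scaleNr scale_iB opprD addrACA.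
  by congr (_ + (_ - _)); rewrite !scalerA mulrC.
have := lowd x; have := mulr_gt0 d0 sx; lra.
Qed.

(** The restriction of [T] to the domain of [T^* T]. *)
Definition product_domain T := [set p : H * H | T p /\ exists z, adjoint T (p.2, z)].

Lemma subspace_product_domain T : subspace T -> subspace (product_domain T).
Proof.
move=> sT; split.
  split; first by case: sT.
  by exists 0; case: (subspace_adjoint T).
move=> c p q [Tp [z hz]] [Tq [w hw]]; split; first exact: sT.2.
by exists (c *: z + w); exact: (subspace_adjoint T).2 c _ _ hz hw.
Qed.

(** The domain of [T^* T] is a core of [T]: this is the surjectivity of
    [1 + T^* T], obtained by projecting vectors [(h, 0)] onto the graph. *)
Lemma product_domain_core T : subspace T -> closed T ->
  (forall y, T (0, y) -> y = 0) ->
  forall p, T p -> forall e : R, 0 < e -> exists q,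
    [/\ product_domain T q, sqnorm (p.1 - q.1) < e & sqnorm (p.2 - q.2) < e].
Proof.
move=> sT cT T0 [x y] Txy.
have sD := subspace_product_domain sT.
have [a [b [clab oab]]] := projection_pair_closure sD x y.
have Tab : T (a, b).
  apply: (closed_sqnorm cT) => e /clab[q [[Tq _] h1 h2]]; by exists q.
have Td := subspaceB sT Txy Tab.
have [u [v [Tuv ouv]]] := projection_pair sT cT (x - a) 0.
have adj : adjoint T (v, x - a - u).
  move=> p q /ouv; rewrite sub0r hdotNl => /eqP; rewrite subr_eq0 => /eqP E.
  by rewrite /= (hdotC v) (hdotC (x - a - u)) E.
have xa : x - a = 0.
  have /oab : product_domain T (u, v) by split=> //; exists (x - a - u).
  rewrite /= -[X in _ + X](_ : '[x - a, x - a - u] = _); last first.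
    by rewrite (adj _ _ Td).
  rewrite -hdotDr subrKC hdotxx => /eqP; rewrite eq_complex /= eqxx andbT.
  by rewrite sqnorm_eq0 => /eqP.
have yb : y - b = 0 by apply: T0; rewrite -xa; exact: Td.
by move/eqP: xa yb; rewrite subr_eq0 => /eqP -> /eqP; rewrite subr_eq0 => /eqP ->.
Qed.

(** If [|S x| = |T x|] on a core of [T], then [dom T] is contained in [dom S],
    because images of approximating sequences are Cauchy together. *)
Lemma dom_sub_core (D T S : set (H * H)) :
  subspace D -> closed S -> subspace S -> (forall y, S (0, y) -> y = 0) ->
  (forall p, T p -> forall e : R, 0 < e -> exists q,
    [/\ D q, sqnorm (p.1 - q.1) < e & sqnorm (p.2 - q.2) < e]) ->
  (forall p, D p -> exists2 y, S (p.1, y) & sqnorm y = sqnorm p.2) ->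
  forall p, T p -> exists y, S (p.1, y).
Proof.
move=> sD cS sS S0 core iso p Tp.
have /choice[u hu] : forall n : nat, exists q : (H * H) * H,
    [/\ D q.1, S (q.1.1, q.2), sqnorm (p.1 - q.1.1) < n.+1%:R^-1 &
        sqnorm (p.2 - q.1.2) < n.+1%:R^-1].
  move=> n; have [|q [Dq h1 h2]] := core _ Tp n.+1%:R^-1; first by rewrite invr_gt0.
  by have [y Sy _] := iso _ Dq; exists (q, y).
have [y hy] : exists l, forall e : R, 0 < e ->
     exists N, forall n, (N <= n)%N -> sqnorm ((u n).2 - l) < e.
  apply: (@sqnorm_complete _ _ (fun n => (u n).2)) => e e0.
  have [|N hN] := @natSinv_small R (e / 4); first by rewrite divr_gt0.
  exists N => n m /hN hn /hN hm.
  have [Dn Sn _ wn] := hu n; have [Dm Sm _ wm] := hu m.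
  have [z Sz nz] := iso _ (subspaceB sD Dn Dm).
  have -> : (u n).2 - (u m).2 = z.
    apply/eqP; rewrite -subr_eq0; apply/eqP/S0.
    rewrite -[X in S (X, _)](subrr ((u n).1.1 - (u m).1.1)).
    exact: subspaceB sS (subspaceB sS Sn Sm) Sz.
  rewrite nz /=; have := sqnorm_dist_le (u n).1.2 p.2 (u m).1.2.
  rewrite (sqnormB _ p.2); have := lt_trans wn hn; have := lt_trans wm hm; lra.
exists y; apply: (closed_sqnorm cS) => e e0 /=.
have [N1 h1] := hy e e0; have [N2 h2] := natSinv_small e0.
have [Dn Sn wn _] := hu (maxn N1 N2).
exists ((u (maxn N1 N2)).1.1, (u (maxn N1 N2)).2); split=> //=.
  by apply: lt_trans wn _; rewrite h2 // leq_maxr.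
by rewrite sqnormB h1 // leq_maxl.
Qed.

End NormalOperators.

(** * Normal operators with nonnegative spectrum *)

Section NormalSpectrum.
Variables (R : realType) (H : hilbertType R).
Implicit Types (x y : H) (A : H -> H) (S T : set (H * H)).

Lemma adjoint_single_valued T : dense (dom T) -> forall y, adjoint T (0, y) -> y = 0.
Proof.
move=> dT y h; apply: (hdot_dense dT) => x [z Txz].
by have := h _ _ Txz; rewrite /= hdot0r hdot0r => <-.
Qed.

Lemma linear_operator_single_valued T : linear_operator T -> forall y, T (0, y) -> y = 0.
Proof. by move=> [T0 _ Tf] y /Tf; apply. Qed.

Lemma sqnorm_hdot (x y z w : H) :
  '[x, x] = '[y, z] -> '[z, y] = '[w, w] -> sqnorm w = sqnorm x.
Proof.
rewrite !hdotxx => /(congr1 (@complex.Re R)) /= E1 /(congr1 (@complex.Re R)) /= E2.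
by rewrite -E2 E1 -!/(rdot _ _) rdotC.
Qed.

(** For [x] in the domain of [T^* T = T T^*], both [|T x|^2] and [|T^* x|^2] are the
    inner product of [x] with the common value of the two products. *)
Lemma normal_dom T : normal T ->
  (forall x y, T (x, y) -> exists z, adjoint T (x, z)) /\
  (forall x z, adjoint T (x, z) -> exists y, T (x, y)).
Proof.
move=> [[lT cT dT] TT]; have sT := linear_operator_subspace lT.
have sT' := subspace_adjoint T; have cT' := @adjoint_closed _ _ T.
have T0 := linear_operator_single_valued lT; have T'0 := adjoint_single_valued dT.
split=> x y Txy.
  apply: (dom_sub_core (subspace_product_domain sT) cT' sT' T'0
           (product_domain_core sT cT T0)) Txy => -[a b] [Tab [c Tbc]].
  have : opmul (adjoint T) T (a, c) by exists b.
  rewrite TT => -[b' /= Tab' Tb'c]; exists b' => //.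
  by apply: sqnorm_hdot (Tbc _ _ Tab) (Tab' _ _ Tb'c).
have core := product_domain_core sT' cT' T'0.
apply: (dom_sub_core (subspace_product_domain sT') cT sT T0 core) Txy.
move=> -[a b] [Tab [c]]; rewrite /= adjoint_adjoint // => Tbc.
have : opmul T (adjoint T) (a, c) by exists b.
rewrite -TT => -[b' /= Tab' Tb'c]; exists b' => //.
by apply: esym; apply: sqnorm_hdot (Tb'c _ _ Tab') (Tab _ _ Tbc).
Qed.

Lemma resolvent_fun T mu : resolvent_set T mu -> exists2 A, bounded_linear A &
  forall x y, T (x, y + mu *: x) <-> A y = x.
Proof.
move=> /bounded_opP[A bA E]; exists A => // x y.
have -> : (A y = x) = graph_of A (y, x) by [].
by rewrite -E.
Qed.

(** With [A = (T + 1)^-1] and [w = A^* A h], the equality of domains shows that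
    [w] is in the domain of [T T^*], and [T T^* w = T^* T w] rearranges to
    [(T^* + 1) (T + 1) w = h]. *)
Lemma resolvent_commute T A A' : normal T ->
  bounded_linear A -> adjoint_fun A A' ->
  (forall x y, T (x, y + (-1) *: x) <-> A y = x) ->
  forall h, A (A' h) = A' (A h).
Proof.
move=> nT bA aA AE; have [[[T0 TP Tf] cT dT] TT] := nT.
have [domT domT'] := normal_dom nT.
have A'E v u : adjoint T (v, u - v) <-> A' u = v.
  have A'T w : adjoint T (A' w, w - A' w).
    move=> x y Txy /=; have Axy : A (y + x) = x by apply/AE; rewrite scaleN1r addrK.
    apply/eqP; rewrite hdotDr hdotNr eq_sym subr_eq -hdotDl -aA Axy.
    by [].
  split=> [h|<- //].
  have := subspaceB (subspace_adjoint T) h (A'T u).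
  rewrite [X in adjoint T X](_ : _ = (v - A' u, - (v - A' u))); last first.
    by congr (_, _); rewrite /= !opprB addrC subrKA.
  set w := v - A' u => hw.
  suff : w = 0 by move/eqP; rewrite subr_eq0 => /eqP.
  apply: hdot_extr => z; rewrite hdot0r.
  have := hw (A z) (z + (-1) *: A z) ((AE _ _).2 erefl) => /=.
  rewrite scaleN1r hdotDl hdotNl hdotNr => /eqP.
  by rewrite subr_eq addNr => /eqP.
move=> h; set u := A h; set w := A' u.
have Tu : T (u, h - u) by have := (AE u h).2 erefl; rewrite scaleN1r.
have Tw : adjoint T (w, u - w) by apply/A'E.
have [p Tp] := domT' _ _ Tw.
have sT : subspace T by [].
have [k Tk] : exists k, T (u - w, k) by exists (h - u - p); exact: subspaceB sT Tu Tp.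
have kE : k = h - u - p by apply: Tf Tk _; exact: subspaceB sT Tu Tp.
have : opmul T (adjoint T) (w, k) by exists (u - w).
rewrite -TT => -[p' /= Tp' Tpk].
have pp : p' = p by apply: Tf Tp' Tp.
rewrite pp kE in Tpk.
have A'h : A' h = w + p.
  apply/A'E; have := subspaceD (subspace_adjoint T) Tw Tpk.
  congr (adjoint T (_, _)) => /=.
  by rewrite addrC [h - u - p]addrAC subrKA opprD addrA addrAC.
rewrite A'h; apply/AE; rewrite scaleN1r.
by rewrite addrC addKr.
Qed.

(** [A - l = - l (T - mu) A] with [mu = l^-1 - 1], so [A - l] is bounded below when [mu]
    is in the resolvent set of [T]. *)
Lemma resolvent_lower_bound T A (l : R[i]) :
  resolvent_set T (l^-1 - 1) -> l != 0 -> bounded_linear A ->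
  (forall x y, T (x, y + (-1) *: x) <-> A y = x) ->
  exists2 d : R, 0 < d & forall x, d * sqnorm x <= sqnorm (A x - l *: x).
Proof.
move=> /resolvent_fun[B bB BE] l0 bA AE; have [M M0 hM] := bB.2.
pose m (c : R[i]) := complex.Re c ^+ 2 + complex.Im c ^+ 2.
have m0 c : 0 <= m c by rewrite addr_ge0 ?sqr_ge0.
pose W := (2 + 2 * m l^-1 * M) * m l^-1 + 1.
have W0 : 0 < W.
  by rewrite ltr_wpDl // mulr_ge0 // addr_ge0 // mulr_ge0 ?mulr_ge0 // ltW.
exists W^-1; first by rewrite invr_gt0.
move=> x; set u := A x; rewrite ler_pdivrMl //.
have Tu : T (u, x + (-1) *: u) by apply/AE.
pose z := x - l^-1 *: u.
have Bz : B z = u.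
  apply/BE; have := Tu; congr (T (_, _)).
  by rewrite /z scalerBl scale1r scaleN1r addrA subrK.
have zE : z = - l^-1 *: (u - l *: x).
  by rewrite scalerBr scalerA mulNr mulVf // scaleN1r scaleNr opprK addrC.
have uz : sqnorm u <= M * sqnorm z by rewrite -Bz.
have sz : sqnorm z = m l^-1 * sqnorm (u - l *: x).
  by rewrite zE sqnormZc !raddfN /= !sqrrN.
have sx : sqnorm x <= 2 * sqnorm z + 2 * (m l^-1 * sqnorm u).
  by rewrite -sqnormZc -[x in leLHS](subrK (l^-1 *: u)) sqnormD_le.
apply: le_trans sx _.
have h1 := ler_wpM2l (m0 l^-1) uz.
have h2 := sqnorm_ge0 (u - l *: x).
rewrite sz in h1 *; rewrite /W; move: h1 h2; set t := sqnorm (u - _); lra.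
Qed.

(** The numerical range of the resolvent [A] at -1 lies in [[0, 1]]. So [A] is
    selfadjoint with [A^2 <= A], and for [w = (T + 1) x] this reads
    [<T x, x> = <w, A w> - |A w|^2 >= 0]. *)
Theorem normal_nonneg_spectrum T : normal T ->
  spectrum T `<=` [set mu | 0 <= mu] -> nonneg_selfadjoint T.
Proof.
move=> nT sp; have [[lT cT dT] TT] := nT.
have [T0 TP Tf] := lT; have sT : subspace T by [].
have [domT domT'] := normal_dom nT.
have res mu : ~~ (0 <= mu) -> resolvent_set T mu.
  by move=> h; apply: contrapT => /sp; exact/negP.
have [|A bA AE] := @resolvent_fun T (-1).
  by apply: res; rewrite oppr_ge0 (lt_geF ltr01).
have [A' bA' aA] := adjoint_fun_exists bA.
have comm := resolvent_commute nT bA aA AE.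
have low (l : R[i]) : ~~ (0 <= l <= 1) ->
    exists2 d : R, 0 < d & forall x, d * sqnorm x <= sqnorm (A x - l *: x).
  move=> hl; have l0 : l != 0 by apply: contra hl => /eqP ->; rewrite lexx ler01.
  apply: (resolvent_lower_bound _ l0 bA AE); apply: res; apply: contra hl.
  rewrite subr_ge0 => h; have l1 : 0 < l^-1 by apply: lt_le_trans h.
  by rewrite invr_gt0 in l1; rewrite (ltW l1) -invf_ge1.
have numrange (k : R[i]) (c : R) : k != 0 ->
    (forall t : R, 0 <= t <= 1 -> complex.Re k * t <= c) ->
    forall x, rdot (k *: A x) x <= c * sqnorm x.
  move=> k0 hk.
  apply: (@numerical_range_le _ _ (fun x => k *: A x) (fun x => cconj k *: A' x)).
  - exact: bounded_linearZ.
  - by move=> x y; rewrite hdotZl hdotZr cconjK aA.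
  - by move=> x; rewrite (blZ _ _ bA) (blZ _ _ bA') comm !scalerA mulrC.
  move=> z hz; have [|d d0 hd] := low (z / k).
    apply/negP; case E : (z / k) => [a b].
    rewrite !lecE /= => /andP[/andP[/eqP b0 a0] /andP[_ a1]].
    have zE : z = k * a%:C by rewrite -[z](divfK k0) E mulrC; congr (k * (_ +i* _)).
    have := hk a; rewrite a0 a1 => /(_ isT); rewrite leNgt => /negP; apply.
    by move: hz; rewrite zE; case: (k) => k1 k2 /=; rewrite mulr0 subr0.
  pose m := complex.Re k ^+ 2 + complex.Im k ^+ 2.
  have m0 : 0 < m.
    rewrite lt_neqAle eq_sym addr_ge0 ?sqr_ge0 // andbT /m paddr_eq0 ?sqr_ge0 // !sqrf_eq0.
    by move: k0; rewrite eq_complex.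
  exists (m * d) => [|x]; first exact: mulr_gt0.
  have -> : k *: A x - z *: x = k *: (A x - (z / k) *: x).
    by rewrite scalerBr scalerA [k * _]mulrC divfK.
  by rewrite sqnormZc -mulrA ler_pM2l.
have A1 x : rdot (A x) x <= sqnorm x.
  have := @numrange 1 1 (oner_neq0 _) _ x; rewrite scale1r mul1r; apply.
  by move=> t /andP[_ t1]; rewrite mul1r.
have A0 x : 0 <= rdot (A x) x.
  have := @numrange (-1) 0 _ _ x; rewrite scaleN1r mul0r rdotNl oppr_le0; apply.
    by rewrite oppr_eq0 oner_neq0.
  by move=> t /andP[t0 _]; rewrite /= mulN1r oppr_le0.
have Ai x : rdot (A x) ('i *: x) = 0.
  have i0 : 'i != 0 :> R[i] by rewrite eq_complex /= oner_eq0 andbF.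
  have h1 := @numrange 'i 0 i0 _ x; have h2 := @numrange (- 'i) 0 _ _ x.
  apply/eqP; rewrite eq_le; apply/andP; split.
    move: h2; rewrite scaleNr rdotNl rdotiC opprK mul0r; apply.
      by rewrite oppr_eq0.
    by move=> t _; rewrite /= oppr0 mul0r.
  move: h1; rewrite rdotiC mul0r oppr_le0; apply.
  by move=> t _; rewrite /= mul0r.
(* polarization of the identity Ai *)
have symA : symmetric_fun A.
  apply: symmetric_funP => // x y.
  have := Ai (x - 'i *: y); rewrite (blB _ _ bA) (blZ _ _ bA) scale_iB scalerA.
  rewrite -expr2 sqr_i scaleN1r opprK !rdotE rdotii rdotiC.
  have := Ai x; have := Ai y; rewrite (rdotC x); lra.
have AA x : sqnorm (A x) <= rdot (A x) x.
  have := form_CS bA symA A0 x (A x); rewrite -/(sqnorm (A x)) => h.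
  have := sqnorm_ge0 (A x); rewrite le0r => /predU1P[->//|s0].
  rewrite -(ler_pM2r s0) -expr2; apply: le_trans h _.
  by rewrite ler_wpM2l.
have TA x y : T (x, y) -> A (y + x) = x.
  by move=> Txy; apply/AE; rewrite scaleN1r addrK.
have sub x y : T (x, y) -> adjoint T (x, y).
  move=> Txy u v Tuv /=.
  have : '[v + u, x] = '[u, y + x].
    by rewrite -{1}(TA _ _ Txy) -symA (TA _ _ Tuv).
  by rewrite hdotDl hdotDr => /addIr.
have nonneg : nonnegative_op T.
  move=> x y Txy; have Ax := TA _ _ Txy.
  have [w wE] : exists w, w = y + x by exists (y + x).
  have yE : y = w - x by rewrite wE addrK.
  rewrite -wE in Ax; rewrite lecE hdotE /= yE !rdotBl; apply/andP; split.
    have h1 := rdotiC w x; have h2 := rdotiC x x; have h3 := Ai w.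
    move: h1 h2 h3; rewrite Ax (rdotC ('i *: w)) (rdotC ('i *: x)) => h1 h2 h3.
    by apply/eqP; lra.
  by have := AA w; rewrite Ax (rdotC w) subr_ge0.
split=> //; split=> //; apply/seteqP; split=> -[x y]; first exact: sub.
move=> Txy; have [y' Txy'] := domT' _ _ Txy.
have := subspaceB (subspace_adjoint T) (sub _ _ Txy') Txy.
rewrite [X in adjoint T X](_ : _ = (0, y' - y)) => [|]; last by congr (_, _); rewrite /= subrr.
by move/(adjoint_single_valued dT)/eqP; rewrite subr_eq0 => /eqP <-.
Qed.

End NormalSpectrum.

(** * Equivalence of the conditions *)

Section Assembly.
Variables (R : realType) (H : hilbertType R).
Implicit Types (x y : H) (f g fs gs : H -> H) (B S T X : set (H * H)).

(** The common reformulation of all conditions, [T = f^-1 S f]. *)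
Definition similar_to_nonneg T := exists f g S,
  [/\ isomorphism f g, nonneg_selfadjoint S & T = transport f f S].

Lemma symmetric_inverse f g : isomorphism f g -> symmetric_fun f -> symmetric_fun g.
Proof. by move=> [_ _ _ gK] sf x y; rewrite -{1}(gK y) -sf gK. Qed.

Lemma pos_invertible_sqrt X : pos_invertible_op X -> exists f g r r',
  [/\ isomorphism f g, X = graph_of f, isomorphism r r',
      symmetric_fun r /\ symmetric_fun r' & f = r \o r /\ g = r' \o r'].
Proof.
move=> /pos_invertible_opP[f [g [iso sf pf ->]]].
have [r [r' [isor sr rr]]] := square_root iso sf pf.
exists f, g, r, r'; split=> //; first by split=> //; exact: symmetric_inverse sr.
have [_ _ fK gK] := iso; have [_ _ rK r'K] := isor.
split; apply: funext => x /=; first by rewrite rr.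
by rewrite -[in RHS](gK x) -rr !rK.
Qed.

Lemma pos_invertible_inverse X : pos_invertible_op X -> exists f g,
  [/\ isomorphism f g, X = graph_of f & pos_invertible_op (graph_of g)].
Proof.
move=> /pos_invertible_opP[f [g [iso sf pf ->]]]; exists f, g; split=> //.
apply/pos_invertible_opP; exists g, f; split=> //.
- exact: isomorphism_sym.
- exact: symmetric_inverse sf.
- by have [_ _ _ gK] := iso; move=> x; rewrite -{2}(gK x) rdotC.
Qed.

(** [F^* F] is in GL^+. *)
Lemma pos_invertible_gram f g fs gs : isomorphism f g ->
  adjoint_fun f fs -> adjoint_fun g gs ->
  isomorphism (fs \o f) (g \o gs) /\ pos_invertible_op (graph_of (fs \o f)).
Proof.
move=> iso af ag; have iso' := isomorphism_adjoint iso af ag.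
have iso2 := isomorphism_comp iso' iso.
split=> //; apply/pos_invertible_opP; exists (fs \o f), (g \o gs); split=> //.
  by move=> x y /=; rewrite (adjoint_fun_sym af) af.
by move=> x /=; rewrite /rdot (adjoint_fun_sym af) -/(rdot _ _) sqnorm_ge0.
Qed.

Lemma selfadjoint_normal S : selfadjoint S -> normal S.
Proof.
move=> [lS dS aS]; split; last by rewrite -aS.
by split=> //; rewrite aS; exact: adjoint_closed.
Qed.

Lemma similar_adjointE f g gs S : isomorphism f g -> adjoint_fun g gs ->
  nonneg_selfadjoint S -> adjoint (transport f f S) = transport gs gs S.
Proof. by move=> iso ag [[_ _ aS] _]; rewrite (adjoint_transport _ iso iso ag ag) -aS. Qed.

Lemma similar_spectrum T : similar_to_nonneg T -> spectrum T `<=` [set mu | 0 <= mu].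
Proof.
move=> [f [g [S [iso nS ->]]]] mu hmu; apply: (nonneg_selfadjoint_spectrum nS) => h.
by apply: hmu; exact: resolvent_set_transport iso _ h.
Qed.

Lemma similar_adjoint T : similar_to_nonneg T -> similar_to_nonneg (adjoint T).
Proof.
move=> [f [g [S [iso nS ->]]]]; have [bf bg _ _] := iso.
have [fs bfs af] := adjoint_fun_exists bf; have [gs bgs ag] := adjoint_fun_exists bg.
exists gs, fs, S; split=> //; last exact: similar_adjointE ag nS.
by apply: isomorphism_sym; exact: isomorphism_adjoint iso af ag.
Qed.

Lemma similar_of_adjoint T : subspace T -> closed T ->
  similar_to_nonneg (adjoint T) -> similar_to_nonneg T.
Proof. by move=> sT cT /similar_adjoint; rewrite adjoint_adjoint. Qed.

(** For [T = F^-1 S F], take [X = F^* F], [Y = X^-1], [B = F^* S F] and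
    [B' = F^-1 S (F^-1)^*]. *)
Lemma similar_factorizations T : similar_to_nonneg T -> exists X Y B B',
  [/\ pos_invertible_op X, pos_invertible_op Y,
      nonneg_selfadjoint B /\ nonneg_selfadjoint B',
      X *o T = B /\ T *o Y = B' &
      [/\ T = Y *o B, T = B' *o X & adjoint T *o X = B]].
Proof.
move=> [f [g [S [iso nS TE]]]]; have [bf bg fK gK] := iso.
have [fs bfs af] := adjoint_fun_exists bf; have [gs bgs ag] := adjoint_fun_exists bg.
have iso' := isomorphism_adjoint iso af ag; have [_ _ fsK gsK] := iso'.
have [isoX pX] := pos_invertible_gram iso af ag.
have [isoY pY] := pos_invertible_gram (isomorphism_sym iso')
  (adjoint_fun_sym ag) (adjoint_fun_sym af).
have aT : adjoint T = transport gs gs S by rewrite TE; exact: similar_adjointE ag nS.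
exists (graph_of (fs \o f)), (graph_of (g \o gs)), (transport f gs S), (transport gs f S).
split=> //.
- split; first exact: nonneg_selfadjoint_transport af ag nS.
  exact: (nonneg_selfadjoint_transport (isomorphism_sym iso') (adjoint_fun_sym ag)
    (adjoint_fun_sym af) nS).
- rewrite (opmul_graphl _ isoX) opmul_graphr TE.
  by rewrite !transport_comp; split; apply: transport_eq => x //=; rewrite gK.
- rewrite (opmul_graphl _ isoY) !opmul_graphr aT TE.
  by rewrite !transport_comp; split; apply: transport_eq => x //=; rewrite ?fsK ?gsK.
Qed.

Lemma similar_W_similar T : similar_to_nonneg T ->
  (exists S, nonneg_selfadjoint S /\ W_similar T S) /\ resolvent_set T !=set0.
Proof.
move=> sT; split.
  have [f [g [S [iso nS ->]]]] := sT; exists S; split=> //; exists (graph_of f).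
  split; first by apply/invertible_opP; exists f, g.
  rewrite (opmul_graphl _ iso) opmul_graphr => -[x y]; rewrite /transport /=.
  by have [_ _ _ ->] := iso.
exists (-1); apply: contrapT => /(similar_spectrum sT) /=.
by rewrite oppr_ge0 (lt_geF ltr01).
Qed.

Lemma similar_scalar T : similar_to_nonneg T -> scalar_op T.
Proof.
move=> [f [g [S [iso nS ->]]]]; exists S; split.
  exact: selfadjoint_normal nS.1.
exists (graph_of g); split.
  by apply/invertible_opP; exists g, f; split=> //; exact: isomorphism_sym.
rewrite (opmul_graphl _ (isomorphism_sym iso)) opmul_graphr.
by rewrite ?transport_comp; apply: transport_eq => x //=; have [_ _ _ ->] := iso.
Qed.

Lemma similar_of_left_product X B : pos_invertible_op X -> nonneg_selfadjoint B ->
  similar_to_nonneg (X *o B).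
Proof.
move=> /pos_invertible_sqrt[f [g [r [r' [iso -> isor [sr sr'] [fE gE]]]]]] nB.
exists r', r, (transport r r' B); split; first exact: isomorphism_sym.
  exact: nonneg_selfadjoint_transport isor sr sr' nB.
rewrite (opmul_graphl _ iso) gE.
by rewrite ?transport_comp; apply: transport_eq => x //=; have [_ _ _ ->] := isor.
Qed.

Lemma similar_of_right_product B X : nonneg_selfadjoint B -> pos_invertible_op X ->
  similar_to_nonneg (B *o X).
Proof.
move=> nB /pos_invertible_sqrt[f [g [r [r' [iso -> isor [sr sr'] [fE gE]]]]]].
exists r, r', (transport r r' B); split=> //.
  exact: nonneg_selfadjoint_transport isor sr sr' nB.
rewrite opmul_graphr fE.
by rewrite ?transport_comp; apply: transport_eq => x //=; have [_ _ -> _] := isor.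
Qed.

Lemma similar_of_right_factor T W : pos_invertible_op W ->
  nonneg_selfadjoint (T *o W) -> similar_to_nonneg T.
Proof.
move=> /pos_invertible_inverse[f [g [[_ _ _ gK] -> pg]]].
rewrite opmul_graphr => nB; have := similar_of_right_product nB pg.
rewrite opmul_graphr; congr similar_to_nonneg.
by apply/seteqP; split=> -[x y]; rewrite /transport /= gK.
Qed.

Lemma similar_of_left_factor T Z : pos_invertible_op Z ->
  nonneg_selfadjoint (Z *o T) -> similar_to_nonneg T.
Proof.
move=> /pos_invertible_inverse[f [g [iso -> pg]]].
rewrite (opmul_graphl _ iso) => nB; have := similar_of_left_product pg nB.
rewrite (opmul_graphl _ (isomorphism_sym iso)); congr similar_to_nonneg.
by have [_ _ fK _] := iso; apply/seteqP; split=> -[x y]; rewrite /transport /= fK.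
Qed.

(** The case where some conjugate of [T] is normal: the conjugate has the spectrum
    of [T]. *)
Lemma similar_of_normal f g T : isomorphism f g -> normal (transport f f T) ->
  spectrum T `<=` [set mu | 0 <= mu] -> similar_to_nonneg T.
Proof.
move=> iso nN sp; exists g, f, (transport f f T); split; first exact: isomorphism_sym.
  apply: normal_nonneg_spectrum nN _ => mu hmu; apply: sp => h; apply: hmu.
  exact: resolvent_set_transport iso _ h.
by have [_ _ _ gK] := iso; rewrite transportK.
Qed.

Lemma similar_of_scalar T : scalar_op T -> spectrum T `<=` [set mu | 0 <= mu] ->
  similar_to_nonneg T.
Proof.
move=> [N [nN [G [/invertible_opP[f [g [iso ->]]]]]]].
rewrite opmul_graphr (opmul_graphl _ iso) => E; apply: (similar_of_normal iso).
have -> // : transport f f T = N.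
have [_ _ fK _] := iso; apply/seteqP; split=> -[x y].
  rewrite -[transport f f T _]/(transport f id T (x, f y)) E /transport /=.
  by rewrite fK.
by move=> h; rewrite -[transport f f T _]/(transport f id T (x, f y)) E /transport /= fK.
Qed.

(** With [X = r^2], the relation [X T = T^* X] says that [r T r^-1] is selfadjoint. *)
Lemma similar_of_symmetrizer T X : closed_densely_defined T -> pos_invertible_op X ->
  X *o T = adjoint T *o X -> spectrum T `<=` [set mu | 0 <= mu] ->
  similar_to_nonneg T.
Proof.
move=> [lT cT dT] /pos_invertible_sqrt[f [g [r [r' [iso -> isor [sr sr'] [fE gE]]]]]].
rewrite opmul_graphr (opmul_graphl _ iso) => E.
have isor' := isomorphism_sym isor; have [_ _ rK r'K] := isor.
apply: (similar_of_normal isor'); apply: selfadjoint_normal; split.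
- exact: (linear_operator_transport isor' isor' lT).
- exact: (dense_dom_transport isor' isor' dT).
rewrite (adjoint_transport _ isor' isor' sr sr).
have -> : transport r r (adjoint T) = transport r' r (transport f id (adjoint T)).
  by rewrite ?transport_comp; apply: transport_eq => x //=; rewrite fE /= r'K.
by rewrite -E !transport_comp; apply: transport_eq => x //=; rewrite gE /= rK.
Qed.

(** [T] is contained in [T' = F^-1 S F], and [T - mu] is onto for some [mu], so the
    equality follows once [S - mu] is injective. An eigenvector [w] of [S] for [mu]
    forces [mu] to be real; then [w] is orthogonal to the range of [S - mu], which is
    everything. *)
Lemma similar_of_W_similar T S : linear_operator T -> nonneg_selfadjoint S ->
  W_similar T S -> resolvent_set T !=set0 -> similar_to_nonneg T.
Proof.
move=> [T0 TP Tf] nS [G [/invertible_opP[f [g [iso ->]]]]].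
rewrite opmul_graphr (opmul_graphl _ iso) => sub [mu /resolvent_fun[A bA AE]].
have [[lS dS aS] pS] := nS; have [bf bg fK gK] := iso.
have subT x y : T (x, y) -> S (f x, f y).
  by move=> Txy; apply: (sub (x, f y)); rewrite /transport /= fK.
exists f, g, S; split=> //; apply/seteqP; split=> -[x y]; first exact: subT.
rewrite /transport /= => Sxy.
pose x0 := A (y - mu *: x).
have Tx0 : T (x0, y - mu *: x + mu *: x0) by apply/AE.
have Sw := subspaceB (linear_operator_subspace lS) Sxy (subT _ _ Tx0).
pose w := f (x - x0).
have {}Sw : S (w, mu *: w).
  have := Sw; congr (S (_, _)) => /=; rewrite /w (blB _ _ bf) //.
  rewrite (blD _ _ bf) (blB _ _ bf) !(blZ _ _ bf) scalerBr opprD opprB addrA.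
  by rewrite subrKC.
suff w0 : w = 0.
  have xx : x = x0.
    by apply/eqP; rewrite -subr_eq0 -[x - x0]fK -/w w0 (bl0 bg).
  by have := Tx0; rewrite -xx subrK.
apply/eqP; rewrite -sqnorm_eq0; apply/negPn/negP => nw.
have s0 : 0 < sqnorm w by rewrite lt_def nw sqnorm_ge0.
have mu_real : cconj mu = mu.
  have := pS _ _ Sw; rewrite hdotZl hdotxx lecE /cconj; case: (mu) => a b /=.
  rewrite mulr0 add0r mulf_eq0 (gt_eqF s0) orbF => /andP[/eqP -> _].
  by rewrite oppr0.
have [u Tu] : exists u, T (u, g w + mu *: u) by exists (A (g w)); apply/AE.
have := subT _ _ Tu; rewrite (blD _ _ bf) gK (blZ _ _ bf) => Su.
move: Sw; rewrite {1}aS => /(_ _ _ Su) /=.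
rewrite hdotDl hdotZl hdotZr mu_real => /eqP; rewrite -subr_eq0 addrK hdotxx.
by rewrite eq_complex /= (gt_eqF s0).
Qed.

Lemma similar_direct_sum T : similar_to_nonneg T ->
  direct_sum_decomposition (closure (ran T)) (ker T).
Proof.
move=> [f [g [S [iso [sS _] ->]]]].
exact: direct_sum_transport iso (selfadjoint_ran_ker sS).
Qed.

End Assembly.

Theorem proposition4p1 (R : realType) (H : hilbertType R) (T : set (H * H))
    (hT : closed_densely_defined T) :
  let i := (exists S, nonneg_selfadjoint S /\ W_similar T S) /\
           resolvent_set T !=set0 in
  let ii := (exists X, pos_invertible_op X /\ X *o T = adjoint T *o X) /\
            spectrum T `<=` [set mu | 0 <= mu] in
  let iii := exists X1 B1, [/\ pos_invertible_op X1, nonneg_selfadjoint B1 &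
                               T = X1 *o B1] in
  let iii' := exists X2 B2, [/\ pos_invertible_op X2, nonneg_selfadjoint B2 &
                                adjoint T = X2 *o B2] in
  let iv := exists B X, [/\ nonneg_selfadjoint B, pos_invertible_op X &
                            T = B *o X] in
  let iv' := exists B' Y, [/\ nonneg_selfadjoint B', pos_invertible_op Y &
                              adjoint T = B' *o Y] in
  let v := exists W, pos_invertible_op W /\ nonneg_selfadjoint (T *o W) in
  let v' := exists Z, pos_invertible_op Z /\ nonneg_selfadjoint (Z *o T) in
  let vi := scalar_op T /\ spectrum T `<=` [set mu | 0 <= mu] in
  [<-> i; ii; iii; iii'; iv; iv'; v; v'; vi] /\
  ([\/ i, ii, iii | iii'] \/ [\/ iv, iv', v | v'] \/ vi ->
   direct_sum_decomposition (closure (ran T)) (ker T)).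
Proof.
have [lT cT dT] := hT; have sT := linear_operator_subspace lT.
move=> i ii iii iii' iv iv' v v' vi.
have iP : i -> similar_to_nonneg T.
  by move=> [[S [nS WS]] rho]; exact: similar_of_W_similar nS WS rho.
have iiP : ii -> similar_to_nonneg T.
  by move=> [[X [pX E]] sp]; exact: similar_of_symmetrizer hT pX E sp.
have iiiP : iii -> similar_to_nonneg T.
  by move=> [X [B [pX nB ->]]]; exact: similar_of_left_product.
have iii'P : iii' -> similar_to_nonneg T.
  move=> [X [B [pX nB E]]]; apply: similar_of_adjoint => //; rewrite E.
  exact: similar_of_left_product.
have ivP : iv -> similar_to_nonneg T.
  by move=> [B [X [nB pX ->]]]; exact: similar_of_right_product.
have iv'P : iv' -> similar_to_nonneg T.
  move=> [B [X [nB pX E]]]; apply: similar_of_adjoint => //; rewrite E.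
  exact: similar_of_right_product.
have vP : v -> similar_to_nonneg T.
  by move=> [W [pW nB]]; exact: similar_of_right_factor pW nB.
have v'P : v' -> similar_to_nonneg T.
  by move=> [Z [pZ nB]]; exact: similar_of_left_factor pZ nB.
have viP : vi -> similar_to_nonneg T.
  by move=> [sc sp]; exact: similar_of_scalar.
split; last first.
  by case=> [[|||]|[[|||]|]] => [/iP|/iiP|/iiiP|/iii'P|/ivP|/iv'P|/vP|/v'P|/viP];
    exact: similar_direct_sum.
have conv : similar_to_nonneg T -> [/\ iii, iv, v & v'] /\ ii.
  move=> hub; have sp := similar_spectrum hub.
  have [X [Y [B [B' [pX pY [nB nB'] [XT TY] [E1 E2 E3]]]]]] := similar_factorizations hub.
  split; last by split=> //; exists X; split=> //; rewrite XT.
  split; [by exists Y, B|by exists B', X|exists Y|exists X].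
    by rewrite TY.
  by rewrite XT.
have conv' : similar_to_nonneg T -> iii' /\ iv'.
  move=> /similar_adjoint hub.
  have [X [Y [B [B' [pX pY [nB nB'] _ [E1 E2 _]]]]]] := similar_factorizations hub.
  by split; [exists Y, B|exists B', X].
tfae.
- by move/iP/conv => -[].
- by move/iiP/conv => -[[]].
- by move/iiiP/conv' => -[].
- by move/iii'P/conv => -[[]].
- by move/ivP/conv' => -[].
- by move/iv'P/conv => -[[]].
- by move/vP/conv => -[[]].
- by move=> /v'P hub; split; [exact: similar_scalar|exact: similar_spectrum].
- by move=> /viP /similar_W_similar.
Qed.
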